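(* Let $(t,x)\in\mathbb{R}_+\times D$ and $p>0$ such that $p+1\in U_{t,x}$. For $k\in\mathbb{R}$ let $c_{t,x}(k)=\mathbb{E}_x[e^{-R_t}(S_t-e^k)^+]$. Then for every $k\in\mathbb{R}$, $$c_{t,x}(k)=\frac{e^{-pk}}{2\pi}\int_{\mathbb{R}}e^{-iyk}g_c(y)\,dy=\frac{e^{-pk}}{\pi}\int_0^\infty\operatorname{Re}\big(e^{-iyk}g_c(y)\big)\,dy,$$ where $$g_c(y)=\frac{h_{t,x}(p+1+iy)}{p^2+p-y^2+iy(2p+1)}.$$
   Context: **The affine process.** Let $D=\mathbb{R}_+^m\times\mathbb{R}^{n-m}$ with $n\ge 1$, $0\le m\le n$; $\mathcal{I}=\{1,\dots,m\}$, $\mathcal{J}=\{m+1,\dots,n\}$; subscripts $\mathcal{I},\mathcal{J}$ on vectors and matrices denote the corresponding components/blocks. $\langle x,y\rangle=\sum_i x_iy_i$ (non-Hermitian, also on $\mathbb{C}^n$). $(X_t,\mathbb{P}_x)_{t\ge0,x\in D}$ is a time-homogeneous $D$-valued Markov process with RCLL paths, $X_0=x$ under $\mathbb{P}_x$, $\mathbb{E}_x$ the expectation under $\mathbb{P}_x$, such that: (H1) $X_t\to X_{t_0}$ in $\mathbb{P}_x$-probability as $t\to t_0$, for all $x\in D$; (H2) there are functions $\phi:\mathbb{R}_+\times i\mathbb{R}^n\to\mathbb{C}$, $\psi:\mathbb{R}_+\times i\mathbb{R}^n\to\mathbb{C}^n$ with $\mathbb{E}_x[\exp(\langle u,X_t\rangle)]=\exp(\phi(t,u)+\langle\psi(t,u),x\rangle)$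 for all $x\in D$, $(t,u)\in\mathbb{R}_+\times i\mathbb{R}^n$. Such a process is Feller, and its generator $\mathcal{A}$ has $C_c^2(D)$ as a core and acts on $f\in C^2_c(D)$ by $$\mathcal{A}f(x)=\sum_{k,l=1}^n\Big(a_{kl}+\sum_{i\in\mathcal I}\alpha_{i,kl}x_i\Big)\frac{\partial^2f(x)}{\partial x_k\partial x_l}+\langle b+\beta x,\nabla f(x)\rangle+\int_{D\setminus\{0\}}\big(f(x+\xi)-f(x)-\langle\nabla_{\mathcal J}f(x),\chi_{\mathcal J}(\xi)\rangle\big)\nu(d\xi)$$ $$+\sum_{i=1}^m\int_{D\setminus\{0\}}\big(f(x+\xi)-f(x)-\langle\nabla_{\mathcal J\cup\{i\}}f(x),\chi_{\mathcal J\cup\{i\}}(\xi)\rangle\big)x_i\,\mu_i(d\xi),$$ where $\chi=(\chi_1,\dots,\chi_n)$, $\chi_k(\xi)=0$ if $\xi_k=0$ and $\chi_k(\xi)=(1\wedge|\xi_k|)\xi_k/|\xi_k|$ otherwise, and the parameters satisfy: (i) $a\in\mathbb{R}^{n\times n}$ symmetric positive semi-definite with $a_{\mathcal{II}}=0$; (ii) for $i\in\mathcal I$, $\alpha_i\in\mathbb{R}^{n\times n}$ symmetric positive semi-definite, all entries of $\alpha_{i,\mathcal{II}}$ being zero except for $\alpha_{i,ii}$; (iii) $b\in D$; (iv) $\beta\in\mathbb{R}^{n\times n}$ with $\beta_{\mathcal{IJ}}=0$ and $\beta_{\mathcal{II}}$ having non-negative off-diagonal elements; (v) $\nu$ is a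 Borel measure on $D\setminus\{0\}$ with $\int(\langle\chi_{\mathcal I}(\xi),\mathbf 1\rangle+\|\chi_{\mathcal J}(\xi)\|^2)\nu(d\xi)<\infty$; (vi) $\mu_i$, $i\in\mathcal I$, are Borel measures on $D\setminus\{0\}$ with $\int(\langle\chi_{\mathcal I\setminus\{i\}}(\xi),\mathbf 1\rangle+\|\chi_{\mathcal J\cup\{i\}}(\xi)\|^2)\mu_i(d\xi)<\infty$; (vii) for all $q\in\mathbb{R}^n$, $\int e^{\langle q,\xi\rangle}1_{\{\|\xi\|\ge1\}}\nu(d\xi)<\infty$ and $\int e^{\langle q,\xi\rangle}1_{\{\|\xi\|\ge1\}}\mu_i(d\xi)<\infty$ for all $i\in\mathcal I$. **The stock model.** Fix $(e,\varepsilon)\in\mathbb{R}\times\mathbb{R}^n$, $(d,\delta)\in\mathbb{R}_+\times\mathbb{R}_+^m$, $(c,\gamma)\in\mathbb{R}_+\times\mathbb{R}_+^m$. Set $s_t=e+\langle\varepsilon,X_t\rangle$, $R_t=\int_0^t(d+\langle\delta,X_{\mathcal I,u}\rangle)du$, $\Lambda_t=\int_0^t(c+\langle\gamma,X_{\mathcal I,u}\rangle)du$, $\tau=\inf\{t\ge0:\Lambda_t=E\}$ with $E$ a standard exponential random variable independent of $X$, and $S_t=\exp(s_t+R_t+\Lambda_t)1_{\{t<\tau\}}$. **Discounted moments.** $U_{t,x}=\{z\in\mathbb{C}:\mathbb{E}_x[e^{-R_t}S_t^{\operatorname{Re}(z)}1_{\{t<\tau\}}]<\infty\}$, and $h_{t,x}(z)=\mathbb{E}_x[e^{-R_t}S_t^z1_{\{t<\tau\}}]$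 for $z\in U_{t,x}$, where $S_t^z=\exp(z(s_t+R_t+\Lambda_t))$ on $\{t<\tau\}$. *)

(* Defs.v *)
From HB Require Import structures.
From mathcomp Require Import all_boot all_order all_algebra.
From mathcomp Require Import complex.
From mathcomp Require Import all_classical all_reals all_analysis.
From mathcomp Require Import measurable_realfun.
Set Implicit Arguments.
Unset Strict Implicit.
Unset Printing Implicit Defensive.
Import Order.TTheory GRing.Theory Num.Theory.
Import numFieldNormedType.Exports.
Local Open Scope classical_set_scope.
Local Open Scope complex_scope.
Local Open Scope ring_scope.

(** * Vectors and complex numbers *)

(* Bilinear, also when [K] is the field of complex numbers (no conjugation). *)
Definition dot (K : comPzRingType) (n : nat) (u v : 'rV[K]_n) : K :=
  \sum_(k < n) u 0 k * v 0 k.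

(* The library norm on ['rV[R]_n] is the sup norm; this is the Euclidean one. *)
Definition enorm (R : realType) (n : nat) (v : 'rV[R]_n) : R :=
  Num.sqrt (dot v v).

(* R^n with its Borel sigma-algebra. *)
Definition borelRn (R : realType) (n : nat) :=
  g_sigma_algebraType (@open 'rV[R]_n).

Definition Cexp (R : realType) (z : R[i]) : R[i] :=
  (expR (complex.Re z))%:C
  * (cos (complex.Im z) +i* sin (complex.Im z)).

Definition Cintegrable (d : measure_display) (T : measurableType d)
    (R : realType) (mu : {measure set T -> \bar R}) (D : set T)
    (f : T -> R[i]) : Prop :=
  mu.-integrable D (EFin \o (fun w => complex.Re (f w))) /\
  mu.-integrable D (EFin \o (fun w => complex.Im (f w))).

Definition Cintegral (d : measure_display) (T : measurableType d)
    (R : realType) (mu : {measure set T -> \bar R}) (D : set T)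
    (f : T -> R[i]) : R[i] :=
  Rintegral mu D (fun w => complex.Re (f w))
  +i* Rintegral mu D (fun w => complex.Im (f w)).

(** * State space and admissible parameters *)

Section StateSpace.
Context (R : realType) (m n : nat) (lemn : (m <= n)%N).

(* Coordinates are numbered from 0: the index set I is ['I_m], embedded in
   ['I_n] by [inI]; the index set J consists of the [k : 'I_n] with
   [(m <= k)%N]. *)
Definition inI : 'I_m -> 'I_n := widen_ord lemn.

Definition projI (x : 'rV[R]_n) : 'rV[R]_m := colsub inI x.

Definition stateD : set 'rV[R]_n := [set x | forall i : 'I_m, 0 <= x 0 (inI i)].

Definition stateD0 : set (borelRn R n) := [set x | stateD x /\ x <> 0].

Definition chi (k : 'I_n) (xi : 'rV[R]_n) : R :=
  if xi 0 k == 0 then 0 else Num.min 1 `|xi 0 k| * (xi 0 k / `|xi 0 k|).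

(* A measure on D \ {0} is represented by a measure on the Borel sets of R^n,
   of which only the restriction to D \ {0} is ever used. *)
Record affine_params := AffineParams {
  par_a : 'M[R]_n ;
  par_alpha : 'I_m -> 'M[R]_n ;
  par_b : 'rV[R]_n ;
  par_beta : 'M[R]_n ;
  par_nu : {measure set (borelRn R n) -> \bar R} ;
  par_mu : 'I_m -> {measure set (borelRn R n) -> \bar R} }.

Definition psd (A : 'M[R]_n) : Prop :=
  A^T = A /\ forall v : 'rV[R]_n, 0 <= (v *m A *m v^T) 0 0.

Record admissible (q : affine_params) : Prop := Admissible {
  adm_a : psd (par_a q) ;
  adm_aII : forall i j : 'I_m, par_a q (inI i) (inI j) = 0 ;
  adm_alpha : forall i, psd (par_alpha q i) ;
  adm_alphaII : forall i j k : 'I_m, (j, k) != (i, i) ->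
    par_alpha q i (inI j) (inI k) = 0 ;
  adm_b : stateD (par_b q) ;
  adm_betaIJ : forall (i : 'I_m) (j : 'I_n), (m <= j)%N ->
    par_beta q (inI i) j = 0 ;
  adm_betaII : forall i j : 'I_m, i != j -> 0 <= par_beta q (inI i) (inI j) ;
  adm_nu : (\int[par_nu q]_(xi in stateD0)
      (\sum_(i < m) chi (inI i) xi
       + \sum_(k < n | (m <= k)%N) chi k xi ^+ 2)%:E < +oo)%E ;
  adm_mu : forall i : 'I_m, (\int[par_mu q i]_(xi in stateD0)
      (\sum_(j < m | j != i) chi (inI j) xi
       + \sum_(k < n | (m <= k)%N || (k == inI i)) chi k xi ^+ 2)%:E < +oo)%E ;
  adm_expnu : forall v : 'rV[R]_n,
    (\int[par_nu q]_(xi in stateD0 `&` [set xi | (1 <= enorm xi)%R])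
      (expR (dot v xi))%:E < +oo)%E ;
  adm_expmu : forall (i : 'I_m) (v : 'rV[R]_n),
    (\int[par_mu q i]_(xi in stateD0 `&` [set xi | (1 <= enorm xi)%R])
      (expR (dot v xi))%:E < +oo)%E }.

(** * Generator *)

Definition partial (k : 'I_n) (f : 'rV[R]_n -> R) : 'rV[R]_n -> R :=
  fun x => 'D_(delta_mx 0 k) f x.

Definition isC1 (f : 'rV[R]_n -> R) : Prop :=
  continuous f /\
  forall k, (forall x, derivable f x (delta_mx 0 k)) /\
            continuous (partial k f).

(* Elements of C_c^2(D) are represented by compactly supported C^2 extensions
   to R^n.  As D is the closure of its interior, the derivatives of the
   extension at the points of D are determined by the restriction to D. *)
Definition Cc2 (f : 'rV[R]_n -> R) : Prop :=
  [/\ isC1 f, forall k, isC1 (partial k f) &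
      compact (closure [set x | f x != 0])].

Definition generator_formula (q : affine_params) (f : 'rV[R]_n -> R)
    (x : 'rV[R]_n) : R :=
  \sum_(k < n) \sum_(l < n)
     (par_a q k l + \sum_(i < m) par_alpha q i k l * x 0 (inI i))
     * partial k (partial l f) x
  + \sum_(k < n)
     (par_b q 0 k + \sum_(l < n) par_beta q k l * x 0 l) * partial k f x
  + Rintegral (par_nu q) stateD0 (fun xi =>
      f (x + xi) - f x
      - \sum_(k < n | (m <= k)%N) partial k f x * chi k xi)
  + \sum_(i < m) Rintegral (par_mu q i) stateD0 (fun xi =>
      (f (x + xi) - f x
       - \sum_(k < n | (m <= k)%N || (k == inI i)) partial k f x * chi k xi)
      * x 0 (inI i)).

(* C_0(D); values outside D are irrelevant. *)
Definition C0D (f : 'rV[R]_n -> R) : Prop :=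
  {within stateD, continuous f} /\
  forall e : R, 0 < e -> exists M : R,
    forall x, stateD x -> M < enorm x -> `|f x| < e.

(** * Affine processes *)

Context (d : measure_display) (Omega : measurableType d).
Context (P : 'rV[R]_n -> probability Omega R).
Context (X : R -> Omega -> borelRn R n).

(* The sigma-algebra generated by [X u] for [u] in [I]. *)
Definition path_sigma (I : set R) : set (set Omega) :=
  <<s [set A | exists u (B : set (borelRn R n)),
         [/\ I u, measurable B & A = X u @^-1` B]] >>.

Definition semigroup (t : R) (f : 'rV[R]_n -> R) (x : 'rV[R]_n) : R :=
  fine 'E_(P x)[fun w => f (X t w)].

Definition is_generator (f g : 'rV[R]_n -> R) : Prop :=
  [/\ C0D f, C0D g & forall e : R, 0 < e -> exists2 h : R, 0 < h &
      forall (t : R) (x : 'rV[R]_n), 0 < t -> t < h -> stateD x ->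
        `|(semigroup t f x - f x) / t - g x| <= e].

(* The simple Markov property with respect to the natural filtration of X;
   the second clause of [markov_property] is E_x[1_A 1_{X_(s+t) in B}] =
   E_x[1_A P_(X_s)(X_t in B)] for A in the sigma-algebra of X up to time s. *)
Definition markov_property : Prop :=
  (forall (t : R) (B : set (borelRn R n)), 0 <= t -> measurable B ->
     measurable_fun (stateD : set (borelRn R n))
       (fun x : borelRn R n => P x (X t @^-1` B))) /\
  (forall (x : 'rV[R]_n) (s t : R) (A : set Omega) (B : set (borelRn R n)),
     stateD x -> 0 <= s -> 0 <= t ->
     path_sigma `[0, s] A -> measurable B ->
     P x (A `&` X (s + t) @^-1` B)
     = (\int[P x]_(w in A) P (X s w) (X t @^-1` B))%E).

Definition rcll : Prop :=
  forall w,
    (forall t : R, 0 <= t ->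
       (fun u => X u w : 'rV[R]_n) @ t^'+ --> (X t w : 'rV[R]_n)) /\
    (forall t : R, 0 < t ->
       exists l : 'rV[R]_n, (fun u => X u w : 'rV[R]_n) @ t^'- --> l).

Definition stochastically_continuous : Prop :=
  forall (x : 'rV[R]_n) (t0 e : R), stateD x -> 0 <= t0 -> 0 < e ->
    (fun t => P x [set w | e <= enorm (X t w - X t0 w : 'rV[R]_n)])
      @ within [set t | 0 <= t] (nbhs t0) --> 0%E.

Definition affine_transform : Prop :=
  exists (phi : R -> 'rV[R[i]]_n -> R[i])
         (psi : R -> 'rV[R[i]]_n -> 'rV[R[i]]_n),
  forall x (t : R) (u : 'rV[R[i]]_n), stateD x -> 0 <= t ->
    (forall k, complex.Re (u 0 k) = 0) ->
    Cintegral (P x) setT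
      (fun w => Cexp (dot u (map_mx (real_complex R) (X t w))))
    = Cexp (phi t u + dot (psi t u) (map_mx (real_complex R) x)).

Record affine_process (q : affine_params) : Prop := AffineProcess {
  ap_measurable : forall t : R, 0 <= t -> measurable_fun setT (X t) ;
  ap_stateD : forall (t : R) w, 0 <= t -> stateD (X t w) ;
  ap_rcll : rcll ;
  ap_start : forall x, stateD x -> P x [set w | X 0 w = x] = 1%E ;
  ap_markov : markov_property ;
  ap_stochcont : stochastically_continuous ;
  ap_affine : affine_transform ;
  ap_feller : forall (t : R) f, 0 <= t -> C0D f -> C0D (semigroup t f) ;
  ap_feller_cont : forall f, C0D f -> forall e : R, 0 < e ->
    exists2 h : R, 0 < h & forall (t : R) (x : 'rV[R]_n), 0 < t -> t < h -> stateD x ->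
      `|semigroup t f x - f x| <= e ;
  ap_generator : forall f, Cc2 f -> is_generator f (generator_formula q f) ;
  ap_core : forall f g, is_generator f g -> forall e : R, 0 < e ->
    exists2 h, Cc2 h & forall x, stateD x ->
      `|h x - f x| <= e /\ `|generator_formula q h x - g x| <= e }.

(** * The stock model *)

Definition std_exponential_indep (E : Omega -> R) : Prop :=
  measurable_fun setT E /\
  forall x, stateD x ->
    (forall B : set R, measurable B -> P x (E @^-1` B) = exponential_prob 1 B) /\
    (forall (A : set Omega) (B : set R),
       path_sigma [set t | 0 <= t] A -> measurable B ->
       P x (A `&` E @^-1` B) = (P x A * P x (E @^-1` B))%E).

Record stock_params := StockParams {
  st_e : R ; st_eps : 'rV[R]_n ;
  st_d : R ; st_delta : 'rV[R]_m ;
  st_c : R ; st_gamma : 'rV[R]_m }.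

Definition stock_admissible (st : stock_params) : Prop :=
  [/\ 0 <= st_d st, forall i, 0 <= st_delta st 0 i,
      0 <= st_c st & forall i, 0 <= st_gamma st 0 i].

Context (st : stock_params) (E : Omega -> R).

Definition log_s (t : R) (w : Omega) : R := st_e st + dot (st_eps st) (X t w).

Definition int_rate (t : R) (w : Omega) : R :=
  Rintegral lebesgue_measure `[0, t]
    (fun u : R => st_d st + dot (st_delta st) (projI (X u w))).

Definition int_hazard (t : R) (w : Omega) : R :=
  Rintegral lebesgue_measure `[0, t]
    (fun u : R => st_c st + dot (st_gamma st) (projI (X u w))).

Definition default_time (w : Omega) : \bar R :=
  ereal_inf [set t%:E | t in [set t : R | 0 <= t /\ int_hazard t w = E w]].

Definition alive (t : R) : set Omega := [set w | (t%:E < default_time w)%E].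

Definition log_S (t : R) (w : Omega) : R :=
  log_s t w + int_rate t w + int_hazard t w.

Definition stock (t : R) (w : Omega) : R := expR (log_S t w) * \1_(alive t) w.

(** * Discounted moments and the call price *)

Definition moment_domain (t : R) (x : 'rV[R]_n) : set R[i] :=
  [set z | ('E_(P x)[fun w => (expR (- int_rate t w)
                        * (stock t w `^ complex.Re z)
                        * \1_(alive t) w)%R] < +oo)%E].

(* Meaningful for [z] in [moment_domain t x]. *)
Definition moment (t : R) (x : 'rV[R]_n) (z : R[i]) : R[i] :=
  Cintegral (P x) setT (fun w =>
    (expR (- int_rate t w))%:C * Cexp (z * (log_S t w)%:C)
    * (\1_(alive t) w)%:C).

(* The expectation of a non-negative variable, valued in [0, +oo]. *)
Definition call_price (t : R) (x : 'rV[R]_n) (k : R) : \bar R :=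
  'E_(P x)[fun w =>
    (expR (- int_rate t w) * Num.max (stock t w - expR k) 0)%R]%E.

Definition g_call (t : R) (x : 'rV[R]_n) (p y : R) : R[i] :=
  moment t x ((p + 1) +i* y)
  / ((p ^+ 2 + p - y ^+ 2) +i* (y * (2 * p + 1))).

End StateSpace.

(* Main.v *)
(* Write [L = log S_t] and [B = e^(-R_t) e^((p+1) L) 1_{t < tau}]; the hypothesis
   [p + 1 \in U_{t,x}] says that [B] is integrable.  With
   [Phi s = (e^(-p s) - e^(-(p+1) s)) 1_{s >= 0}] the payoff is
   [e^(-R_t) (S_t - e^k)^+ = e^(-pk) B Phi(L - k)], and the Fourier transform of
   [Phi] at [y] is [1 / ((p + iy)(p + 1 + iy))], the reciprocal of the denominator
   of [g_c].  So the formula is Fourier inversion for the continuous function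
   [Phi], at the point [L - k], followed by Fubini's theorem.  The inversion is
   obtained by damping with [e^(-eps y)], which turns the double integral into the
   Poisson integral of [Phi], and letting [eps] tend to [0].  Right
   continuity of the paths makes [R_t] and [Lambda_t] measurable, and continuity
   of [Lambda] reduces [{t < tau}] to a condition on [Lambda_t] and [E]. *)
Require Import Defs.
From mathcomp Require Import all_boot all_order all_algebra.
From mathcomp Require Import complex ring lra.
From mathcomp Require Import all_classical all_reals all_analysis.
From mathcomp Require Import measurable_realfun.
Import Order.TTheory GRing.Theory Num.Theory.
Import numFieldNormedType.Exports.
Local Open Scope classical_set_scope.
Local Open Scope complex_scope.
Local Open Scope ring_scope.

(** * Fubini's theorem under a product bound *)

Lemma le_integrableR d (T : measurableType d) (R : realType)
    (mu : {measure set T -> \bar R}) (D : set T) (f g : T -> R) :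
  measurable D -> measurable_fun D g ->
  (forall x, D x -> `|g x| <= f x) ->
  mu.-integrable D (EFin \o f) -> mu.-integrable D (EFin \o g).
Proof.
move=> mD mg gf intf; apply: (le_integrable mD _ _ intf).
  exact/measurable_EFinP.
by move=> x Dx; rewrite lee_fin (le_trans (gf _ Dx))// ler_norm.
Qed.

Section dominated_fubini.
Context d1 d2 (T1 : measurableType d1) (T2 : measurableType d2) (R : realType).
Variables (m1 : {sigma_finite_measure set T1 -> \bar R}).
Variables (m2 : {sigma_finite_measure set T2 -> \bar R}).
Variables (D1 : set T1) (D2 : set T2) (f : T1 -> R) (g : T2 -> R).
Hypotheses (mD1 : measurable D1) (mD2 : measurable D2).
Hypotheses (intf : m1.-integrable D1 (EFin \o f)).
Hypotheses (intg : m2.-integrable D2 (EFin \o g)).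
Variable F : T1 -> T2 -> R.
Hypothesis mF : measurable_fun setT (fun z => F z.1 z.2).
Hypothesis leF : forall x y, D1 x -> D2 y -> `|F x y| <= f x * g y.

(** Extension of [F] by zero, which turns integrals over [D1] and [D2] into integrals over the full
    product space. *)
Let H (z : T1 * T2) : R := F z.1 z.2 * \1_D1 z.1 * \1_D2 z.2.

Let mH : measurable_fun setT H.
Proof.
apply: measurable_funM; first apply: measurable_funM => //.
  by apply: measurableT_comp => //; exact: measurable_indic.
by apply: measurableT_comp => //; exact: measurable_indic.
Qed.

Let HE x y : D1 x -> D2 y -> H (x, y) = F x y.
Proof. by move=> Dx Dy; rewrite /H/= !indicE !mem_set// !mulr1. Qed.

Let H1 x y : ~ D1 x -> H (x, y) = 0.
Proof. by move=> Dx; rewrite /H/= !indicE memNset// mulr0 mul0r. Qed.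

Let H2 x y : ~ D2 y -> H (x, y) = 0.
Proof. by move=> Dy; rewrite /H/= !indicE (memNset Dy) mulr0. Qed.

(** By Tonelli it is enough to bound the iterated integral of [|H|], and this is at most the product
    of the integrals of [|f|] over [D1] and [|g|] over [D2]. Absolute values enter because only the
    products [f x * g y] are known to be non-negative. *)
Let intH : (m1 \x m2)%E.-integrable setT (EFin \o H).
Proof.
apply/integrable12ltyP; first exact/measurable_EFinP.
have mf : measurable_fun setT (f \_ D1).
  apply/(measurable_restrictT _ mD1).1/measurable_EFinP.
  exact: (measurable_int m1).
have mg : measurable_fun setT (g \_ D2).
  apply/(measurable_restrictT _ mD2).1/measurable_EFinP.
  exact: (measurable_int m2).
have maf : measurable_fun setT (fun x => `|(f \_ D1) x|%:E).
  by apply/measurable_EFinP; exact: measurableT_comp.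
have mag : measurable_fun setT (fun x => `|(g \_ D2) x|%:E).
  by apply/measurable_EFinP; exact: measurableT_comp.
have /integrableP[_ i1] := (integrable_mkcond _ mD1).1 intf.
have /integrableP[_ i2] := (integrable_mkcond _ mD2).1 intg.
rewrite restrict_EFin/= in i1; rewrite restrict_EFin/= in i2.
pose c := fine (\int[m2]_y `|(g \_ D2) y|%:E)%E.
have cE : (\int[m2]_y `|(g \_ D2) y|%:E)%E = c%:E.
  by rewrite fineK// ge0_fin_numE//; exact: integral_ge0.
have c0 : (0 <= c%:E)%E by rewrite -cE integral_ge0.
apply: (@le_lt_trans _ _ (\int[m1]_x (c%:E * `|(f \_ D1) x|%:E))%E); last first.
  by rewrite ge0_integralZl//= lte_mul_pinfty.
apply: ge0_le_integral => //=.
- by move=> x _; exact: integral_ge0.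
- have mabsH : measurable_fun setT (fun z => `|(H z)%:E|%E).
    by apply: measurableT_comp => //; exact/measurable_EFinP.
  exact: (measurable_fun_fubini_tonelli_F (m2 := m2) _ mabsH).
- exact: measurable_funeM.
move=> x _; rewrite -cE muleC -ge0_integralZl//=.
apply: ge0_le_integral => //=.
- apply/measurable_EFinP; apply: measurableT_comp => //.
  exact: (measurableT_comp mH (pair1_measurable x)).
- exact: measurable_funeM.
move=> y _; rewrite -EFinM lee_fin.
have [Dx|Dx] := pselect (D1 x); last by rewrite H1// normr0 mulr_ge0.
have [Dy|Dy] := pselect (D2 y); last by rewrite H2// normr0 mulr_ge0.
rewrite !patchE !mem_set//= HE// (le_trans (leF _ _ Dx Dy))//.
by rewrite -normrM ler_norm.
Qed.

Lemma dominated_section1_integrable x : D1 x ->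
  m2.-integrable D2 (fun y => (F x y)%:E).
Proof.
move=> Dx; apply: (@le_integrableR _ _ _ _ _ (fun y => f x * g y)) => //.
- apply: measurable_funTS; have := measurableT_comp mF (pair1_measurable x).
  exact.
- by move=> y; exact: leF.
- by apply: (eq_integrable _ (fun y => (f x)%:E * (g y)%:E)%E) => //;
    exact: integrableZl.
Qed.

Lemma dominated_section2_integrable y : D2 y ->
  m1.-integrable D1 (fun x => (F x y)%:E).
Proof.
move=> Dy; apply: (@le_integrableR _ _ _ _ _ (fun x => f x * g y)) => //.
- apply: measurable_funTS; have := measurableT_comp mF (pair2_measurable y).
  exact.
- by move=> x Dx; exact: leF.
- by apply: (eq_integrable _ (fun x => (f x)%:E * (g y)%:E)%E) => //;
    exact: integrableZr.
Qed.

Let HF x : D1 x -> (\int[m2]_y (H (x, y))%:E = (\int[m2]_(y in D2) F x y)%:E)%E.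
Proof.
move=> Dx; rewrite /Rintegral fineK; last first.
  by apply: integrable_fin_num => //; exact: dominated_section1_integrable.
rewrite integral_mkcond; apply: eq_integral => y _; rewrite patchE.
case: ifPn => [/set_mem Dy|/negP/(contra_not mem_set) Dy]; first by rewrite HE.
by rewrite H2.
Qed.

Let HG y : D2 y -> (\int[m1]_x (H (x, y))%:E = (\int[m1]_(x in D1) F x y)%:E)%E.
Proof.
move=> Dy; rewrite /Rintegral fineK; last first.
  by apply: integrable_fin_num => //; exact: dominated_section2_integrable.
rewrite integral_mkcond; apply: eq_integral => x _; rewrite patchE.
case: ifPn => [/set_mem Dx|/negP/(contra_not mem_set) Dx]; first by rewrite HE.
by rewrite H1.
Qed.

Lemma dominated_integrable1 :
  m1.-integrable D1 (fun x => (\int[m2]_(y in D2) F x y)%:E).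
Proof.
apply: (eq_integrable mD1 (fubini_F m2 (EFin \o H))).
  by move=> x /set_mem Dx; rewrite /fubini_F /= HF.
apply: (integrableS measurableT) => //.
exact: integrable_fubini_F.
Qed.

Lemma dominated_Fubini :
  \int[m1]_(x in D1) (\int[m2]_(y in D2) F x y) =
  \int[m2]_(y in D2) (\int[m1]_(x in D1) F x y).
Proof.
rewrite /Rintegral; congr fine.
transitivity (\int[m1]_x \int[m2]_y (EFin \o H) (x, y))%E.
  rewrite integral_mkcond; apply: eq_integral => x _; rewrite patchE.
  case: ifPn => [/set_mem Dx|/negP/(contra_not mem_set) Dx]; first by rewrite HF.
  by under eq_integral do rewrite /= H1//; rewrite integral0.
rewrite (Fubini intH) [RHS]integral_mkcond; apply: eq_integral => y _.
rewrite patchE.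
case: ifPn => [/set_mem Dy|/negP/(contra_not mem_set) Dy]; first by rewrite HG.
by under eq_integral do rewrite /= H2//; rewrite integral0.
Qed.

End dominated_fubini.

Lemma dominated_integrable2 d1 d2 (T1 : measurableType d1)
    (T2 : measurableType d2) (R : realType)
    (m1 : {sigma_finite_measure set T1 -> \bar R})
    (m2 : {sigma_finite_measure set T2 -> \bar R})
    (D1 : set T1) (D2 : set T2) (f : T1 -> R) (g : T2 -> R) :
  measurable D1 -> measurable D2 ->
  m1.-integrable D1 (EFin \o f) -> m2.-integrable D2 (EFin \o g) ->
  forall F : T1 -> T2 -> R,
  measurable_fun setT (fun z => F z.1 z.2) ->
  (forall x y, D1 x -> D2 y -> `|F x y| <= f x * g y) ->
  m2.-integrable D2 (fun y => (\int[m1]_(x in D1) F x y)%:E).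
Proof.
move=> mD1 mD2 intf intg F mF leF.
apply: (dominated_integrable1 _ _ _ _ _ m2 m1 D2 D1 g f _ _ _ _
  (fun y x => F x y)) => //.
- have := measurableT_comp mF (@measurable_swap _ _ T2 T1).
  exact.
- by move=> y x Dy Dx; rewrite mulrC; exact: leF.
Qed.

(** * Fourier inversion for a difference of exponentials *)

Section poisson.
Context {R : realType}.
Notation mu := (@lebesgue_measure R).
Implicit Types a b c s x y th : R.

Lemma ge0_integral_0y_derive (f F : R -> R) l :
  (forall s, is_derive s 1 F (f s)) -> continuous f -> (forall s, 0 <= f s) ->
  F s @[s --> +oo] --> l ->
  (\int[mu]_(s in `[0%R, +oo[) (f s)%:E = (l - F 0)%:E)%E.
Proof.
move=> dF cf f0 Fl; rewrite EFinB; apply: ge0_continuous_FTC2y => //.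
- exact: continuous_subspaceT.
- apply: cvg_at_right_filter; apply: differentiable_continuous.
  by apply/derivable1_diffP; have [] := dF 0.
- by move=> x _; rewrite derive1E; have [_] := dF x.
Qed.

(** This is the real part of the antiderivative [- e^(-(c + iy) s + i th) / (c + iy)] of
    [e^(-(c + iy) s + i th)]. *)
Lemma decay_antiderivative c y th s : 0 < c ->
  is_derive s 1 (fun s => - (expR (- (c * s)) *
      (c * cos (th - y * s) + y * sin (th - y * s)) / (c ^+ 2 + y ^+ 2)))
    (expR (- (c * s)) * cos (th - y * s)).
Proof.
move=> c0; have cy : c ^+ 2 + y ^+ 2 != 0.
  by rewrite gt_eqF// ltr_wpDr ?sqr_ge0// exprn_gt0.
have de : is_derive s 1 (fun s => expR (- (c * s))) (expR (- (c * s)) * - c).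
  apply: (is_derive1_comp (f := expR)).
  by apply: is_derive_eq; rewrite /GRing.scale/= mulr1.
have dl : is_derive s 1 (fun s => th - y * s) (- y).
  by apply: is_derive_eq; rewrite /GRing.scale/= add0r mul1r mulr1.
have dc : is_derive s 1 (fun s => cos (th - y * s)) (- sin (th - y * s) * - y).
  exact: (is_derive1_comp (f := cos)).
have ds : is_derive s 1 (fun s => sin (th - y * s)) (cos (th - y * s) * - y).
  exact: (is_derive1_comp (f := sin)).
apply: is_derive_eq; rewrite /GRing.scale/=.
field.
exact: cy.
Qed.


Lemma cvg_decay c : 0 < c -> expR (- (c * s)) @[s --> +oo] --> (0 : R).
Proof.
move=> c0; apply: (@cvg_comp _ _ _ ( *%R c) (fun s => expR (- s)) _ +oo).
  by apply: gt0_cvgMry => //; exact: cvg_id.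
exact: cvgr_expR.
Qed.

Lemma cvg_decay_antiderivative c y th : 0 < c ->
  - (expR (- (c * s)) *
      (c * cos (th - y * s) + y * sin (th - y * s)) / (c ^+ 2 + y ^+ 2))
    @[s --> +oo] --> (0 : R).
Proof.
move=> c0; pose M := (c + `|y|) / (c ^+ 2 + y ^+ 2).
have cy : 0 < c ^+ 2 + y ^+ 2 by rewrite ltr_wpDr ?sqr_ge0// exprn_gt0.
apply: (squeeze_cvgr (f := fun s => - (expR (- (c * s)) * M))
  (h := fun s => expR (- (c * s)) * M)).
- apply: nearW => s; rewrite -ler_norml normrN -!mulrA !normrM.
  rewrite (ger0_norm (expR_ge0 _)) ler_wpM2l ?expR_ge0//.
  rewrite [X in _ * X]ger0_norm ?invr_ge0 ?(ltW cy)// ler_pM2r ?invr_gt0//.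
  rewrite (le_trans (ler_normD _ _))// !normrM (gtr0_norm c0) lerD//.
    by rewrite ler_piMr ?cos_max// ltW.
  by rewrite ler_piMr ?sin_max.
- rewrite -oppr0 -(mul0r M); apply: cvgN.
  by apply: cvgM (cvg_cst _); exact: cvg_decay.
- by rewrite -(mul0r M); apply: cvgM (cvg_cst _); exact: cvg_decay.
Qed.

Lemma continuous_decay c : continuous (fun s => expR (- (c * s))).
Proof.
move=> s; apply: continuous_comp; last exact: continuous_expR.
by apply: continuousN; apply: continuousM; [exact: cst_continuous|exact: cvg_id].
Qed.

Lemma continuous_cos_affine th y : continuous (fun s => cos (th - y * s)).
Proof.
move=> s; apply: continuous_comp; last exact: continuous_cos.
apply: continuousB; first exact: cst_continuous.
by apply: continuousM; [exact: cst_continuous|exact: cvg_id].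
Qed.

Lemma decay_integrable c : 0 < c ->
  mu.-integrable `[0, +oo[ (fun s => (expR (- (c * s)))%:E).
Proof.
move=> c0; apply/integrableP; split.
  apply/measurable_EFinP; apply: measurable_funTS.
  by apply: continuous_measurable_fun; exact: continuous_decay.
(* The pure exponential is the case [th = y = 0] of the antiderivative above. *)
have E s : expR (- (c * s)) = expR (- (c * s)) * cos (0 - 0 * s).
  by rewrite mul0r subr0 cos0 mulr1.
have dF s : is_derive s 1 (fun s => - (expR (- (c * s)) *
    (c * cos (0 - 0 * s) + 0 * sin (0 - 0 * s)) / (c ^+ 2 + 0 ^+ 2)))
    (expR (- (c * s))).
  by rewrite [X in is_derive _ _ _ X]E; exact: decay_antiderivative.
have H := ge0_integral_0y_derive (fun s => expR (- (c * s))) _ 0 dF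
  (continuous_decay c) (fun s => expR_ge0 _) (cvg_decay_antiderivative c 0 0 c0).
rewrite [ltLHS](_ : _ = \int[mu]_(s in `[0%R, +oo[) (expR (- (c * s)))%:E)%E.
  by rewrite H ltry.
by apply: eq_integral => s _ /=; rewrite ger0_norm ?expR_ge0.
Qed.

Lemma decay_dominated c (f : R -> R) : 0 < c -> measurable_fun setT f ->
  (forall s, `|f s| <= 1) ->
  mu.-integrable `[0, +oo[ (fun s => (expR (- (c * s)) * f s)%:E).
Proof.
move=> c0 mf f1.
apply: (le_integrableR _ _ _ _ _ _ _ _ _ _ (decay_integrable c c0)) => //.
  apply: measurable_funTS; apply: measurable_funM => //.
  by apply: continuous_measurable_fun; exact: continuous_decay.
by move=> s _; rewrite normrM ger0_norm ?expR_ge0// ler_piMr ?expR_ge0.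
Qed.

(* [cos] changes sign, so the improper fundamental theorem of calculus is
   applied to the nonnegative functions [e^(-cs)(1 + cos)] and [e^(-cs)]. *)
Lemma Rintegral_decay_cos c y th : 0 < c ->
  \int[mu]_(s in `[0, +oo[) (expR (- (c * s)) * cos (th - y * s)) =
  (c * cos th + y * sin th) / (c ^+ 2 + y ^+ 2).
Proof.
move=> c0; pose f s := expR (- (c * s)) * cos (th - y * s).
(* [g] is [e^(-c s)] written with zero phase and frequency, so that [f + g] is
   [e^(-c s) (1 + cos (th - y s))] and both antiderivatives have the same form. *)
pose g s := expR (- (c * s)) * cos (0 - 0 * s).
have mcos u v : measurable_fun setT (fun s => cos (u - v * s)).
  by apply: continuous_measurable_fun; exact: continuous_cos_affine.
have cf u v : continuous (fun s => expR (- (c * s)) * cos (u - v * s)).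
  move=> s; apply: cvgM; first exact: continuous_decay.
  exact: continuous_cos_affine.
have intf : mu.-integrable `[0, +oo[ (EFin \o f).
  by apply: decay_dominated => // s; exact: cos_max.
have intg : mu.-integrable `[0, +oo[ (EFin \o g).
  by apply: decay_dominated => // s; exact: cos_max.
have gE s : g s = expR (- (c * s)) by rewrite /g mul0r subr0 cos0 mulr1.
have gI : \int[mu]_(s in `[0, +oo[) g s = c / (c ^+ 2).
  rewrite /Rintegral (ge0_integral_0y_derive _ _ 0
    (fun s => decay_antiderivative c 0 0 s c0) (cf _ _) _
    (cvg_decay_antiderivative c 0 0 c0))/=.
  - by rewrite !mulr0 mul0r subr0 cos0 oppr0 expR0 expr0n !addr0 !mulr1 sub0r opprK mul1r.
  - by move=> s; rewrite -/(g s) gE expR_ge0.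
have fgI : \int[mu]_(s in `[0, +oo[) (f s + g s) =
    (c * cos th + y * sin th) / (c ^+ 2 + y ^+ 2) + c / (c ^+ 2).
  have FGl := cvgD (FF := proper_pinfty_nbhs) (cvg_decay_antiderivative c y th c0)
    (cvg_decay_antiderivative c 0 0 c0).
  rewrite addr0 in FGl.
  have dFG s := is_deriveD (decay_antiderivative c y th s c0)
    (decay_antiderivative c 0 0 s c0).
  rewrite /Rintegral (ge0_integral_0y_derive (fun s => f s + g s) _ 0 dFG _ _ FGl)/=.
  - rewrite fctE !mulr0 mul0r !subr0 cos0 oppr0 expR0 expr0n !addr0 !mulr1 !mul1r.
    by rewrite sub0r opprD !opprK.
  - by move=> s; apply: cvgD; exact: cf.
  - move=> s; rewrite gE /f addrC -{1}[expR _]mulr1 -mulrDr.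
    apply: mulr_ge0; first exact: expR_ge0.
    have := cos_max (th - y * s); rewrite ler_norml => /andP[+ _].
    by rewrite -subr_ge0 opprK addrC.
by move: fgI; rewrite RintegralD// gI => /addIr.
Qed.

End poisson.

Lemma dominated_cvg_Rintegral d (T : measurableType d) (R : realType)
    (mu : {measure set T -> \bar R}) (D : set T) (f_ : nat -> T -> R)
    (f g : T -> R) : measurable D ->
  (forall n, measurable_fun D (f_ n)) ->
  (forall x, D x -> f_ n x @[n --> \oo] --> f x) ->
  mu.-integrable D (EFin \o g) ->
  (forall n x, D x -> `|f_ n x| <= g x) ->
  mu.-integrable D (EFin \o f) /\
  \int[mu]_(x in D) f_ n x @[n --> \oo] --> \int[mu]_(x in D) f x.
Proof.
move=> mD mf_ f_f ig f_g.
have mf : measurable_fun D f by exact: measurable_fun_cvg f_f.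
have [|||||intf _ H] := @dominated_convergence _ _ _ mu D mD
  (fun n => EFin \o f_ n) (EFin \o f) (EFin \o g).
- by move=> n; exact/measurable_EFinP.
- exact/measurable_EFinP.
- by apply: aeW => x Dx; apply: cvg_EFin; [exact: nearW|exact: f_f].
- exact: ig.
- by apply: aeW => x n Dx; rewrite lee_fin f_g.
split=> //; apply: fine_cvg.
by rewrite /Rintegral fineK//; exact: integrable_fin_num.
Qed.

(** * Lorentzian bounds and the Fourier transform of a gap of exponentials *)

Section exp_gap.
Context {R : realType}.
Notation mu := (@lebesgue_measure R).

Lemma sum_sqr_gt0 (c y : R) : 0 < c -> 0 < c ^+ 2 + y ^+ 2.
Proof. by move=> c0; rewrite ltr_wpDr ?sqr_ge0// exprn_gt0. Qed.

Lemma continuous_lorentz (c : R) : 0 < c ->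
  continuous (fun y : R => (c ^+ 2 + y ^+ 2)^-1).
Proof.
move=> c0 y; apply: cvgV; first by rewrite gt_eqF ?sum_sqr_gt0.
by apply: cvgD; [exact: cvg_cst|exact: exprn_continuous].
Qed.

Lemma measurable_lorentz (c : R) : 0 < c ->
  measurable_fun setT (fun y : R => (c ^+ 2 + y ^+ 2)^-1).
Proof.
by move=> c0; apply: continuous_measurable_fun; exact: continuous_lorentz.
Qed.

Lemma integral_lorentz1 : (\int[mu]_y ((1 ^+ 2 + y ^+ 2)^-1)%:E = pi%:E)%E.
Proof.
have c1 := continuous_lorentz 1 ltr01.
have l0 (y : R) : 0 <= (1 ^+ 2 + y ^+ 2)^-1.
  by rewrite invr_ge0 ltW// sum_sqr_gt0.
rewrite (ge0_symfun_integralT l0 c1); last by move=> y /=; rewrite sqrrN.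
have dF (y : R) : is_derive y 1 (@atan R) (1 ^+ 2 + y ^+ 2)^-1.
  by rewrite expr1n; exact: is_derive1_atan.
rewrite -set_itvcy (ge0_integral_0y_derive _ _ (pi / 2) dF c1 l0 (@cvgy_atan R)).
by rewrite atan0 subr0 -EFinM mulrC divfK.
Qed.

Lemma lorentz1_integrable :
  mu.-integrable setT (fun y => ((1 ^+ 2 + y ^+ 2)^-1)%:E).
Proof.
apply/integrableP; split.
  by apply/measurable_EFinP; exact: measurable_lorentz.
rewrite [ltLHS](_ : _ = \int[mu]_y ((1 ^+ 2 + y ^+ 2)^-1)%:E)%E.
  by rewrite integral_lorentz1 ltry.
apply: eq_integral => y _ /=.
by rewrite ger0_norm ?invr_ge0// ltW// sum_sqr_gt0.
Qed.

Lemma lorentz_integrable (c : R) : 0 < c ->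
  mu.-integrable setT (fun y => ((c ^+ 2 + y ^+ 2)^-1)%:E).
Proof.
(* This [M] gives [1 + y^2 <= M (c^2 + y^2)], hence a comparison with the case [c = 1]. *)
move=> c0; pose M := 1 + (c ^+ 2)^-1.
apply: (le_integrableR _ _ _ mu setT (fun y => M * (1 ^+ 2 + y ^+ 2)^-1)
  (fun y => (c ^+ 2 + y ^+ 2)^-1)) => //.
- exact: measurable_lorentz.
- move=> y _; rewrite ger0_norm ?invr_ge0 ?(ltW (sum_sqr_gt0 _ _ c0))//.
  rewrite ler_pdivlMr ?sum_sqr_gt0// mulrC ler_pdivrMr ?sum_sqr_gt0//.
  have c2 : 0 < c ^+ 2 by rewrite exprn_gt0.
  rewrite /M mulrDl mul1r mulrDr mulVf ?gt_eqF//.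
  have := sqr_ge0 y; have : 0 <= (c ^+ 2)^-1 * y ^+ 2.
    by rewrite mulr_ge0 ?sqr_ge0// invr_ge0 ltW.
  rewrite expr1n; lra.
- exact: (integrableZl measurableT M lorentz1_integrable).
Qed.

Variables a b : R.
Hypotheses (a0 : 0 < a) (ab : a < b).

Let b0 : 0 < b. Proof. exact: lt_trans ab. Qed.

(** The function [Phi] for general rates [a < b]. The truncation at [0] makes both exponentials
    equal to [1] for [s <= 0], so the difference vanishes there and is continuous on the whole line;
    inversion then holds at every point. *)
Definition exp_gap (s : R) : R :=
  expR (- (a * Num.max s 0)) - expR (- (b * Num.max s 0)).

(* [exp_gap_hat] and [exp_gap_hat_im] are the real and imaginary parts of
   [e^(iyx) / (a + iy) - e^(iyx) / (b + iy)]. *)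
Definition exp_gap_hat (y x : R) : R :=
  (a * cos (y * x) + y * sin (y * x)) / (a ^+ 2 + y ^+ 2)
  - (b * cos (y * x) + y * sin (y * x)) / (b ^+ 2 + y ^+ 2).

Definition exp_gap_hat_im (y x : R) : R :=
  (a * sin (y * x) - y * cos (y * x)) / (a ^+ 2 + y ^+ 2)
  - (b * sin (y * x) - y * cos (y * x)) / (b ^+ 2 + y ^+ 2).

Lemma exp_gap_bound s : 0 <= exp_gap s <= expR (- (a * Num.max s 0)).
Proof.
rewrite /exp_gap lerBlDr lerDl expR_ge0 andbT subr_ge0 ler_expR lerN2.
by rewrite ler_wpM2r ?(ltW ab)// le_max lexx orbT.
Qed.

Lemma exp_gap_le1 s : `|exp_gap s| <= 1.
Proof.
have /andP[h0 h1] := exp_gap_bound s; rewrite ger0_norm// (le_trans h1)//.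
by rewrite -expR0 ler_expR oppr_le0 mulr_ge0 ?(ltW a0)// le_max lexx orbT.
Qed.

Lemma continuous_exp_gap : continuous exp_gap.
Proof.
have h c : continuous (fun s : R => expR (- (c * Num.max s 0))).
  move=> s; apply: (@continuous_comp _ _ _ (fun s : R => Num.max s 0)
      (fun s : R => expR (- (c * s)))); last exact: continuous_decay.
  by apply: continuous_max; [exact: cvg_id|exact: cst_continuous].
by move=> s; apply: cvgB; exact: h.
Qed.

(* The left-hand side is [(b - a) |Re (u / ((a + iy)(b + iy)))|], where
   [u = C + iS] has modulus [1]. *)
Lemma lorentz_gap_bound (y C S : R) : C ^+ 2 + S ^+ 2 = 1 ->
  `|(a * C + y * S) / (a ^+ 2 + y ^+ 2) - (b * C + y * S) / (b ^+ 2 + y ^+ 2)|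
  <= (b - a) / (a ^+ 2 + y ^+ 2).
Proof.
move=> CS; have A := sum_sqr_gt0 _ y a0; have B := sum_sqr_gt0 _ y b0.
rewrite [X in `|X| <= _](_ : _ = (b - a) / (a ^+ 2 + y ^+ 2) *
    (((a * b - y ^+ 2) * C + y * (a + b) * S) / (b ^+ 2 + y ^+ 2))); last first.
  by field; rewrite !gt_eqF.
rewrite normrM [X in X * _]ger0_norm; last first.
  by rewrite divr_ge0 ?(ltW A)// subr_ge0 ltW.
rewrite ler_piMr//; first by rewrite divr_ge0 ?(ltW A)// subr_ge0 ltW.
rewrite normrM (ger0_norm (_ : 0 <= (b ^+ 2 + y ^+ 2)^-1)) ?invr_ge0 ?(ltW B)//.
rewrite ler_pdivrMr// mul1r -ler_sqr ?nnegrE ?(ltW B)// real_normK ?num_real//.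
have AB : a ^+ 2 + y ^+ 2 <= b ^+ 2 + y ^+ 2.
  by rewrite lerD2r ler_sqr ?nnegrE ?ltW.
(* The numerator is the real part of [u] times the conjugate of [(a + iy)(b + iy)], so its square is
   at most the squared modulus [(a^2 + y^2)(b^2 + y^2)]. *)
apply: (@le_trans _ _ ((a ^+ 2 + y ^+ 2) * (b ^+ 2 + y ^+ 2))); last first.
  by rewrite expr2 ler_wpM2r// ltW.
have -> : (a ^+ 2 + y ^+ 2) * (b ^+ 2 + y ^+ 2) =
    ((a * b - y ^+ 2) * C + y * (a + b) * S) ^+ 2 +
    ((a * b - y ^+ 2) * S - y * (a + b) * C) ^+ 2.
  transitivity (((a * b - y ^+ 2) ^+ 2 + (y * (a + b)) ^+ 2) * (C ^+ 2 + S ^+ 2)).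
    by rewrite CS mulr1; ring.
  by ring.
by rewrite lerDl sqr_ge0.
Qed.

Lemma exp_gap_hat_bound y x : `|exp_gap_hat y x| <= (b - a) / (a ^+ 2 + y ^+ 2).
Proof. exact/lorentz_gap_bound/cos2Dsin2. Qed.

(** Multiplying [e^(iyx)] by [-i] turns the imaginary part into a real part, so the bound for real
    parts applies with [C = sin (y x)] and [S = - cos (y x)]. *)
Lemma exp_gap_hat_im_bound y x :
  `|exp_gap_hat_im y x| <= (b - a) / (a ^+ 2 + y ^+ 2).
Proof.
have CS : sin (y * x) ^+ 2 + (- cos (y * x)) ^+ 2 = 1.
  by rewrite sqrrN addrC cos2Dsin2.
by have := lorentz_gap_bound y _ _ CS; rewrite !mulrN.
Qed.

Lemma exp_gap_hatN y x : exp_gap_hat (- y) x = exp_gap_hat y x.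
Proof. by rewrite /exp_gap_hat !mulNr cosN sinN !mulrN !opprK sqrrN. Qed.

Lemma exp_gap_hat_imN y x : exp_gap_hat_im (- y) x = - exp_gap_hat_im y x.
Proof.
by rewrite /exp_gap_hat_im !mulNr cosN sinN sqrrN; ring.
Qed.

Lemma measurable_exp_gap_hat_comp d (T : measurableType d) (f g : T -> R) :
  measurable_fun setT f -> measurable_fun setT g ->
  measurable_fun setT (fun w => exp_gap_hat (f w) (g w)) /\
  measurable_fun setT (fun w => exp_gap_hat_im (f w) (g w)).
Proof.
move=> mf mg; have mfg := measurable_funM mf mg.
have mc : measurable_fun setT (fun w => cos (f w * g w)).
  apply: (measurableT_comp (f := @cos R)) => //.
  by apply: continuous_measurable_fun; exact: continuous_cos.
have ms : measurable_fun setT (fun w => sin (f w * g w)).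
  apply: (measurableT_comp (f := @sin R)) => //.
  by apply: continuous_measurable_fun; exact: continuous_sin.
have ml (c : R) : 0 < c -> measurable_fun setT (fun w => (c ^+ 2 + f w ^+ 2)^-1).
  move=> c0; apply: (measurableT_comp (f := fun y : R => (c ^+ 2 + y ^+ 2)^-1)) => //.
  exact: measurable_lorentz.
split.
  apply: measurable_funB;
    (apply: measurable_funM; last by apply: ml => //; exact: lt_trans ab);
    by apply: measurable_funD; apply: measurable_funM.
apply: measurable_funB;
  (apply: measurable_funM; last by apply: ml => //; exact: lt_trans ab);
  by apply: measurable_funB; apply: measurable_funM.
Qed.

(** On [[0, +oo[] the maximum disappears, and [Rintegral_decay_cos] with phase [th = y * x]
    evaluates each of the two exponentials. *)
Lemma exp_gap_hatE y x :
  exp_gap_hat y x = \int[mu]_(s in `[0, +oo[) (exp_gap s * cos (y * x - y * s)).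
Proof.
rewrite /exp_gap_hat -(Rintegral_decay_cos _ _ _ a0).
rewrite -(Rintegral_decay_cos _ _ _ b0).
rewrite -RintegralB//=.
- apply: eq_Rintegral => s; rewrite inE/= in_itv/= andbT => s0.
  by rewrite /exp_gap max_l// mulrBl.
- apply: decay_dominated => //; last by move=> s; exact: cos_max.
  by apply: continuous_measurable_fun; exact: continuous_cos_affine.
- apply: decay_dominated => //; last by move=> s; exact: cos_max.
  by apply: continuous_measurable_fun; exact: continuous_cos_affine.
Qed.

End exp_gap.

(** * Inversion by damping and the Poisson kernel *)

Section inversion.
Context {R : realType}.
Notation mu := (@lebesgue_measure R).
Variables a b : R.
Hypotheses (a0 : 0 < a) (ab : a < b).
Notation exp_gap := (exp_gap a b).
Notation exp_gap_hat := (exp_gap_hat a b).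

Let measurable_exp_gap : measurable_fun setT exp_gap.
Proof. by apply: continuous_measurable_fun; exact: continuous_exp_gap. Qed.

(** With the damping factor the double integrand is dominated by [e^(-e y) e^(-a s)] on the
    quadrant, so the order of integration can be exchanged. The inner integral over [y] is then the
    Poisson kernel at [s - x]. *)
Lemma regularized_inversion_Fubini (e x : R) : 0 < e ->
  \int[mu]_(y in `[0, +oo[) (expR (- (e * y)) * exp_gap_hat y x) =
  \int[mu]_(s in `[0, +oo[) (exp_gap s * (e / (e ^+ 2 + (s - x) ^+ 2))).
Proof.
move=> e0; pose F y s := expR (- (e * y)) * (exp_gap s * cos (y * x - y * s)).
have mF : measurable_fun setT (fun z : R * R => F z.1 z.2).
  have m1 : measurable_fun setT (fun z : R * R => z.1) by exact: measurable_fst.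
  have m2 : measurable_fun setT (fun z : R * R => z.2) by exact: measurable_snd.
  apply: measurable_funM; last apply: measurable_funM.
  - apply: (measurableT_comp (f := fun y => expR (- (e * y)))) => //.
    by apply: continuous_measurable_fun; exact: continuous_decay.
  - exact: measurableT_comp.
  - apply: (measurableT_comp (f := @cos R)).
      by apply: continuous_measurable_fun; exact: continuous_cos.
    by apply: measurable_funB; apply: measurable_funM.
have leF y s : `[0, +oo[%classic y -> `[0, +oo[%classic s ->
    `|F y s| <= expR (- (e * y)) * expR (- (a * s)).
  rewrite /= !in_itv/= !andbT => y0 s0; have /andP[h0 h1] := exp_gap_bound a b ab s.
  rewrite max_l// in h1.
  rewrite normrM (ger0_norm (expR_ge0 _)) ler_wpM2l ?expR_ge0//.
  rewrite normrM (ger0_norm h0).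
  by rewrite (le_trans _ h1)// ler_piMr// cos_max.
have H := dominated_Fubini _ _ _ _ _ mu mu `[0, +oo[ `[0, +oo[ _ _ _ _
  (decay_integrable e e0) (decay_integrable a a0) F mF leF.
transitivity (\int[mu]_(y in `[0, +oo[) \int[mu]_(s in `[0, +oo[) F y s).
  apply: eq_Rintegral => y _; rewrite exp_gap_hatE// -RintegralZl//.
  apply: (le_integrableR _ _ _ mu `[0, +oo[ (fun s => expR (- (a * s)))) => //.
  - apply: measurable_funTS; apply: measurable_funM => //.
    by apply: continuous_measurable_fun; exact: continuous_cos_affine.
  - move=> s; rewrite /= in_itv/= andbT => s0.
    have /andP[h0 h1] := exp_gap_bound a b ab s; rewrite max_l// in h1.
    by rewrite normrM (ger0_norm h0) (le_trans _ h1)// ler_piMr// cos_max.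
  - exact: decay_integrable.
rewrite H//; apply: eq_Rintegral => s _.
(* The phase [y x - y s] is read as [0 - (s - x) y], so the integral over [y] is a decaying cosine
   integral with [th = 0]. *)
transitivity (\int[mu]_(y in `[0, +oo[)
    (exp_gap s * (expR (- (e * y)) * cos (0 - (s - x) * y)))).
  apply: eq_Rintegral => y _; rewrite /F mulrCA; congr (_ * (_ * cos _)); ring.
rewrite RintegralZl//.
  by rewrite Rintegral_decay_cos// cos0 sin0 mulr0 addr0 mulr1.
apply: decay_dominated => //; last by move=> y; exact: cos_max.
by apply: continuous_measurable_fun; exact: continuous_cos_affine.
Qed.

(** Since [exp_gap] vanishes on the negative half-line, the integral extends to the whole line. The
    substitution [s = x + e v] then moves [e] into the argument of [exp_gap] and leaves a kernel
    independent of [e]. *)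
Lemma exp_gap_poisson (e x : R) : 0 < e ->
  \int[mu]_(s in `[0, +oo[) (exp_gap s * (e / (e ^+ 2 + (s - x) ^+ 2))) =
  \int[mu]_v (exp_gap (x + e * v) / (1 ^+ 2 + v ^+ 2)).
Proof.
move=> e0; pose G s := exp_gap s * (e / (e ^+ 2 + (s - x) ^+ 2)).
have G0 s : 0 <= G s.
  have /andP[h0 _] := exp_gap_bound a b ab s.
  by rewrite mulr_ge0// divr_ge0 ?ltW// sum_sqr_gt0.
have cG : continuous G.
  move=> s; apply: cvgM; first exact: continuous_exp_gap.
  apply: cvgM; first exact: cvg_cst.
  apply: (@continuous_comp _ _ _ (fun s : R => s - x)
    (fun u => (e ^+ 2 + u ^+ 2)^-1)); last exact: continuous_lorentz.
  by apply: cvgB; [exact: cvg_id|exact: cvg_cst].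
have dF (v : R) : is_derive v 1 (fun v : R => x + e * v) e.
  by apply: is_derive_eq; rewrite /GRing.scale/= add0r mul1r mulr1.
have dFE : (fun v : R => x + e * v)^`()%classic = cst e.
  by apply/funext => v; rewrite derive1E; have [_] := dF v.
have e2 : e != 0 by rewrite gt_eqF.
rewrite Rintegral_mkcond.
transitivity (\int[mu]_s G s).
  apply: eq_Rintegral => s _; rewrite patchE; case: ifPn => // /negP.
  rewrite inE/= in_itv/= andbT => /negP; rewrite -ltNge => s0.
  by rewrite /G /exp_gap max_r ?ltW// !mulr0 subrr mul0r.
rewrite /Rintegral (increasing_ge0_integration_by_substitutionT
  (F := fun v => x + e * v))//.
- congr fine; apply: eq_integral => v _; rewrite dFE/= !fctE/= /G.
  congr (_%:E); have := sum_sqr_gt0 1 v ltr01; rewrite expr1n => /gt_eqF/negbT v0.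
  field.
  rewrite v0 /= gt_eqF// [x + _]addrC addrK.
  exact: sum_sqr_gt0.
- by move=> u v uv; rewrite ltrD2l ltr_pM2l.
- by rewrite dFE; exact: cst_continuous.
- by rewrite dFE; exact: is_cvg_cst.
- by rewrite dFE; exact: is_cvg_cst.
- apply: (@cvg_comp _ _ _ ( *%R e) (fun u => x + u) _ -oo).
    by apply: gt0_cvgMrNy => //; exact: cvg_id.
  exact: cvg_addrl_Ny.
- apply: (@cvg_comp _ _ _ ( *%R e) (fun u => x + u) _ +oo).
    by apply: gt0_cvgMry => //; exact: cvg_id.
  exact: cvg_addrl.
Qed.

(** Both sides of the damped identity converge by dominated convergence along [1/(n+1)]: the damped
    integral to the undamped one, the Poisson integral to [exp_gap x] times the total mass [pi] of
    [1 / (1 + v^2)]. Uniqueness of limits concludes. *)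
Theorem exp_gap_inversion x :
  mu.-integrable `[0, +oo[ (fun y => (exp_gap_hat y x)%:E) /\
  \int[mu]_(y in `[0, +oo[) exp_gap_hat y x = pi * exp_gap x.
Proof.
pose e n : R := n.+1%:R^-1; have e0 n : 0 < e n by rewrite invr_gt0.
have eto0 : e n @[n --> \oo] --> (0 : R) by exact: cvg_harmonic.
have ig : mu.-integrable `[0, +oo[ (fun y => ((b - a) / (a ^+ 2 + y ^+ 2))%:E).
  apply: integrableS (integrableZl measurableT (b - a) (lorentz_integrable a a0)) => //.
have [mhat _] := measurable_exp_gap_hat_comp a b a0 ab _ _ id (cst x)
  (@measurable_id _ _ _) (measurable_cst x).
have [|||||ihat cvgl] := dominated_cvg_Rintegral _ _ _ mu `[0, +oo[
  (fun n y => expR (- (e n * y)) * exp_gap_hat y x) (exp_gap_hat ^~ x)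
  (fun y => (b - a) / (a ^+ 2 + y ^+ 2)).
- by [].
- move=> n; apply: measurable_funTS; apply: measurable_funM => //.
  by apply: continuous_measurable_fun; exact: continuous_decay.
- move=> y _; have H : expR (- (e n * y)) @[n --> \oo] --> (1 : R).
    rewrite -expR0; apply: (@cvg_comp _ _ _ (fun n => - (e n * y)) (@expR R) _ (nbhs 0)).
      by rewrite -oppr0 -(mul0r y); apply: cvgN; apply: cvgM => //; exact: cvg_cst.
    exact: continuous_expR.
  by have := cvgM H (cvg_cst (exp_gap_hat y x)); rewrite mul1r; exact.
- exact: ig.
- move=> n y; rewrite /= in_itv/= andbT => y0.
  rewrite normrM (ger0_norm (expR_ge0 _)).
  apply: le_trans (exp_gap_hat_bound a b a0 ab y x).
  by rewrite ler_piMl// -expR0 ler_expR oppr_le0 mulr_ge0// ltW.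
split=> //; apply: (cvg_unique _ cvgl) => //.
have [|||||_ cvgr] := dominated_cvg_Rintegral _ _ _ mu setT
  (fun n v => exp_gap (x + e n * v) / (1 ^+ 2 + v ^+ 2))
  (fun v => exp_gap x / (1 ^+ 2 + v ^+ 2)) (fun v => (1 ^+ 2 + v ^+ 2)^-1).
- by [].
- move=> n; apply: measurable_funM; last exact: measurable_lorentz.
  apply: measurableT_comp => //.
  apply: continuous_measurable_fun => v; apply: cvgD; first exact: cvg_cst.
  by apply: cvgM; [exact: cvg_cst|exact: cvg_id].
- move=> v _; apply: cvgM; last exact: cvg_cst.
  apply: (@cvg_comp _ _ _ (fun n => x + e n * v) exp_gap _ (nbhs x)).
    have := cvgD (cvg_cst x) (cvgM eto0 (cvg_cst v)).
    by rewrite mul0r addr0; exact.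
  exact: continuous_exp_gap.
- exact: lorentz1_integrable.
- move=> n v _; rewrite normrM [X in _ * X <= _]ger0_norm; last first.
    by rewrite invr_ge0 ltW// sum_sqr_gt0.
  by rewrite ler_piMl ?exp_gap_le1// invr_ge0 ltW// sum_sqr_gt0.
have <- : \int[mu]_v (exp_gap x / (1 ^+ 2 + v ^+ 2)) = pi * exp_gap x.
  rewrite RintegralZl//; last exact: lorentz1_integrable.
  by rewrite mulrC /Rintegral integral_lorentz1.
rewrite (_ : (fun n => _) =
  (fun n => \int[mu]_v (exp_gap (x + e n * v) / (1 ^+ 2 + v ^+ 2))))//.
apply/funext => n.
by rewrite regularized_inversion_Fubini// exp_gap_poisson.
Qed.

End inversion.

(** * Integrals along regulated paths *)

Section regulated_paths.
Context d (Omega : measurableType d) (R : realType).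
Notation mu := (@lebesgue_measure R).
Variable Y : R -> Omega -> R.
Hypothesis mY : forall u, 0 <= u -> measurable_fun setT (Y u).
Hypothesis Y_right : forall w u, 0 <= u -> Y v w @[v --> u^'+] --> Y u w.
Hypothesis Y_left : forall w u, 0 < u -> exists l : R, Y v w @[v --> u^'-] --> l.
Hypothesis Y_ge0 : forall u w, 0 <= u -> 0 <= Y u w.

(* The next point to the right of [u] on the grid of mesh [1/(n+1)]. *)
Let grid (n : nat) (u : R) : R := (Num.truncn (u * n.+1%:R)).+1%:R / n.+1%:R.

Let grid_gt n u : u < grid n u.
Proof. by rewrite /grid ltr_pdivlMr// truncnS_gt. Qed.

Let grid_cvg u : 0 <= u -> grid n u @[n --> \oo] --> u^'+.
Proof.
move=> u0; have gu : grid n u @[n --> \oo] --> u.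
  apply: (squeeze_cvgr (f := fun=> u) (h := fun n => u + n.+1%:R^-1)).
  - apply: nearW => n; rewrite ltW//= /grid ler_pdivrMr// mulrDl mulVf//.
    by rewrite -natr1 lerD2r truncn_le mulr_ge0.
  - exact: cvg_cst.
  - have := cvgD (cvg_cst u) (@cvg_harmonic R); rewrite addr0; exact.
move=> A /gu H.
have {}H : \forall n \near \oo, u < grid n u -> A (grid n u) by exact: H.
by apply: (filterS _ H) => n; apply; exact: grid_gt.
Qed.

(** By right continuity [Y u] is the limit of [Y] at the grid points. On each strip where the grid
    point is constant, the approximation depends on [w] alone and is measurable. *)
Lemma regulated_jointly_measurable :
  measurable_fun [set z : Omega * R | 0 <= z.2] (fun z => Y z.2 z.1).
Proof.
apply: (@measurable_fun_cvg _ _ R [set z : Omega * R | 0 <= z.2]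
  (fun n z => Y (grid n z.2) z.1)); last first.
  move=> [w u]/= u0; apply: (@cvg_comp _ _ _ (grid ^~ u) (Y ^~ w) _ u^'+).
    exact: grid_cvg.
  exact: Y_right.
move=> n; pose D j : set (Omega * R) := setT `*` `[j%:R / n.+1%:R, j.+1%:R / n.+1%:R[.
have -> : [set z : Omega * R | 0 <= z.2] = \bigcup_j D j.
  apply/seteqP; split=> [[w u]/= u0|[w u] [j _ [_ /=]]]; last first.
    by rewrite in_itv/= => /andP[+ _]; apply: le_trans; rewrite divr_ge0.
  exists (Num.truncn (u * n.+1%:R)) => //; split=> //=.
  by rewrite in_itv/= grid_gt andbT ler_pdivrMr// truncn_le mulr_ge0.
apply/measurable_fun_bigcup => [j|j]; first exact: measurableX.
apply: (eq_measurable_fun (fun z => Y (j.+1%:R / n.+1%:R) z.1)).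
  move=> [w u]; rewrite inE => -[_ /=]; rewrite in_itv/= => /andP[h1 h2].
  rewrite /grid; congr (Y (_.+1%:R / _) _); apply/esym/truncn_def.
  by rewrite -ler_pdivrMr// h1 -ltr_pdivlMr.
apply: measurable_funTS; apply: measurableT_comp => //.
by apply: mY; rewrite divr_ge0.
Qed.

(** Extension of the paths by zero to negative times, so that joint measurability holds on the full
    product. *)
Let Z (z : Omega * R) : R :=
  ((fun z => Y z.2 z.1) \_ [set z : Omega * R | 0 <= z.2]) z.

Let ZE w u : 0 <= u -> Z (w, u) = Y u w.
Proof. by move=> u0; rewrite /Z patchE mem_set. Qed.

Let mZ : measurable_fun setT Z.
Proof.
have mD : measurable [set z : Omega * R | 0 <= z.2].
  rewrite (_ : mkset _ = setT `*` `[0, +oo[); first exact: measurableX.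
  apply/seteqP; split=> [[w u]/= u0|[w u] [_ /=]]; last by rewrite in_itv/= andbT.
  by split=> //=; rewrite in_itv/= u0.
by have := (measurable_restrictT _ mD).1 regulated_jointly_measurable; exact.
Qed.

Definition path_integral (t : R) (w : Omega) : R :=
  Rintegral mu `[0, t] (fun u : R => Y u w).

Lemma path_integral_measurable t : measurable_fun setT (path_integral t).
Proof.
pose f (z : Omega * R) : \bar R := (Z z * \1_(`[0, t]%classic) z.2)%:E.
have mf : measurable_fun setT f.
  apply/measurable_EFinP/measurable_funM => //.
  by apply: measurableT_comp => //; exact: measurable_indic.
have f0 z : (0 <= f z)%E.
  rewrite lee_fin mulr_ge0// /Z patchE; case: ifPn => // /set_mem.
  exact: Y_ge0.
rewrite (_ : path_integral t = fine \o fubini_F mu f).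
  apply: measurableT_comp => //.
  exact: (measurable_fun_fubini_tonelli_F (m2 := mu) _ mf).
apply/funext => w; rewrite /path_integral /Rintegral /= /fubini_F.
congr fine; rewrite [LHS]integral_mkcond; apply: eq_integral => u _.
rewrite patchE /f/= indicE; case: ifPn => ut; last by rewrite mulr0.
by rewrite mulr1 ZE//; move/set_mem: ut; rewrite /= in_itv/= => /andP[].
Qed.

(** Compactness of [[0, t]]: around each [u] the right limit controls the path just after [u] and
    the left limit controls it just before. *)
Lemma regulated_bounded w t : exists M, forall u, 0 <= u <= t -> `|Y u w| <= M.
Proof.
have cov : \forall M \near +oo%R, `[0, t]%classic `<=` (fun u => `|Y u w| <= M).
  have /compact_near_coveringP/near_covering_withinP := @segment_compact R 0 t.
  apply => u; rewrite /= in_itv/= => /andP[u0 ut].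
  have nr : \forall v \near u, u < v -> `|Y v w| <= `|Y u w| + 1.
    have /cvgrPdist_le/(_ 1 ltr01) h := Y_right w u u0.
    apply: (filterS _ (h : \forall v \near u, u < v -> `|Y u w - Y v w| <= 1)).
    move=> v hv uv; rewrite -lerBlDl (le_trans (lerB_dist _ _))// distrC.
    exact: hv.
  have [K nl] : exists K, \forall v \near u, 0 <= v -> v < u -> `|Y v w| <= K.
    (* At [u = 0] no admissible time lies to the left, so any bound serves, here [0]. *)
    move: u0; rewrite le_eqVlt => /predU1P[<-|u0].
      by exists 0; near=> v => v0; rewrite ltNge v0.
    have [l Yl] := Y_left w u u0.
    have /cvgrPdist_le/(_ 1 ltr01) h := Yl; exists (`|l| + 1).
    apply: (filterS _ (h : \forall v \near u, v < u -> `|l - Y v w| <= 1)).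
    move=> v hv _ vu; rewrite -lerBlDl (le_trans (lerB_dist _ _))// distrC.
    exact: hv.
  near=> v M => /=; rewrite in_itv/= => /andP[v0 vt].
  have [vu|uv|->] := ltgtP v u.
  - apply: (@le_trans _ _ K); last by near: M; apply: nbhs_pinfty_ge; exact: num_real.
    by move: v0 vu; near: v; exact: nl.
  - apply: (@le_trans _ _ (`|Y u w| + 1)).
      by move: uv; near: v; exact: nr.
    by near: M; apply: nbhs_pinfty_ge; exact: num_real.
  - by near: M; apply: nbhs_pinfty_ge; exact: num_real.
have [M hM] := filter_ex cov.
by exists M => u ut; apply: hM; rewrite /= in_itv.
Unshelve. all: by end_near. Qed.

Lemma regulated_integrable w t : mu.-integrable `[0, t] (fun u => (Y u w)%:E).
Proof.
have [M hM] := regulated_bounded w t.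
have mYw : measurable_fun (`[0, t]%classic : set R) (Y ^~ w).
  apply: (@eq_measurable_fun _ _ _ _ _ (fun u => Z (w, u))).
    by move=> u; rewrite inE/= in_itv/= => /andP[u0 _]; rewrite ZE.
  by apply: measurable_funTS; exact: (measurableT_comp mZ (pair1_measurable w)).
have fin_t : (mu (`[0%R, t]%classic : set R) < +oo)%E.
  by rewrite lebesgue_measure_itv/=; case: ifPn; rewrite ?ltry.
apply: measurable_bounded_integrable => //.
- exists M; split; first exact: num_real.
  move=> K MK u; rewrite /= in_itv/= => ut.
  by rewrite (le_trans (hM _ ut))// ltW.
Qed.

Lemma path_integral0 w : path_integral 0 w = 0.
Proof. by rewrite /path_integral set_itv1 Rintegral_set1. Qed.

Lemma path_integral_homo w s t : 0 <= s -> s <= t ->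
  path_integral s w <= path_integral t w.
Proof.
move=> s0 st; rewrite -subr_ge0 /path_integral Rintegral_itvB.
- by apply: Rintegral_ge0 => u; rewrite /= in_itv/= => /andP[su _];
    rewrite Y_ge0// (le_trans s0)// ltW.
- exact: regulated_integrable.
- by rewrite bnd_simp.
- by rewrite bnd_simp.
Qed.

Lemma path_integral_continuous w t : 0 <= t ->
  {within `[0, t], continuous (path_integral ^~ w)}.
Proof.
move=> t0; apply: parameterized_integral_continuous => //.
exact: regulated_integrable.
Qed.

(** With [Y] the hazard rate and [a = E w] this unfolds to [default_time]. *)
Definition hitting_time (a : R) (w : Omega) : \bar R :=
  ereal_inf [set s%:E | s in [set s : R | 0 <= s /\ path_integral s w = a]].

(* The level [a] is hit by time [t] exactly when [0 <= a <= path_integral t w]: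
   the infimum of the hitting times cannot be [t] without being attained, by
   continuity. *)
Lemma before_hitting_level w (a t : R) : 0 <= t ->
  (t%:E < hitting_time a w)%E <-> a < 0 \/ path_integral t w < a.
Proof.
move=> t0; have I0 s : 0 <= s -> 0 <= path_integral s w.
  by move=> s0; rewrite -(path_integral0 w) path_integral_homo.
split=> [tinf|].
  apply: contrapT => /not_orP[/negP + /negP]; rewrite -!leNgt => a0 ta.
  have [] := @IVT _ (path_integral ^~ w) 0 t a t0 (path_integral_continuous w t t0).
    by rewrite path_integral0 min_l ?I0// max_r ?I0// a0.
  move=> s; rewrite in_itv/= => /andP[s0 st] sa.
  suff : (t%:E < t%:E)%E by rewrite ltxx.
  apply: (lt_le_trans tinf); apply: (@le_trans _ _ s%:E); last by rewrite lee_fin.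
  by by apply: ereal_inf_lbound; exists s.
case=> [a_lt0|ta].
  (* The path integral is non-negative, so a negative level is never hit and the infimum of the
     empty set is [+oo]. *)
  rewrite /hitting_time (_ : [set _ | _ in _] = set0) ?ereal_inf0 ?ltry//.
  apply/seteqP; split=> // r [s [s0 sa] _].
  by have := I0 s s0; rewrite sa leNgt a_lt0.
have t1 : 0 < t + 1 by rewrite ltr_wpDl.
(* By continuity the integral stays below [a] a little beyond [t], and monotonicity then excludes
   every hitting time before [t + e]. Continuity is taken on [[0, t + 1]] to have room on the right
   of [t], whence the cap [1] on [e]. *)
have [e e0 he] : exists2 e, 0 < e & path_integral (t + e) w < a.
  have /subspace_continuousP/(_ t) := path_integral_continuous w (t + 1) (ltW t1).
  rewrite /= in_itv/= t0 lerDl ler01 => /(_ isT)/cvgr_lt/(_ a ta).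
  rewrite /within/= => /nbhs_ballP[r /= r0 hr].
  exists (Num.min (r / 2) 1); first by rewrite lt_min divr_gt0/=.
  set e := Num.min _ _.
  have e0 : 0 < e by rewrite lt_min divr_gt0/=.
  apply: hr; last by rewrite in_itv/= addr_ge0 ?(ltW e0)// lerD2l ge_min lexx orbT.
  rewrite /ball/= opprD addrA subrr sub0r normrN gtr0_norm//.
  by rewrite gt_min ltr_pdivrMr// ltr_pMr// ltr1n.
apply: (@lt_le_trans _ _ (t + e)%:E); first by rewrite lte_fin ltrDl.
apply/ereal_infP => _ [s [s0 sa] <-]; rewrite lee_fin leNgt; apply/negP => se.
by move: he; rewrite ltNge -sa path_integral_homo// ltW.
Qed.

Lemma survival_measurable (E : Omega -> R) t : 0 <= t -> measurable_fun setT E ->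
  measurable [set w | (t%:E < hitting_time (E w) w)%E].
Proof.
move=> t0 mE.
rewrite (_ : mkset _ = E @^-1` `]-oo, 0[ `|`
    (fun w => E w - path_integral t w) @^-1` `]0, +oo[).
  apply: measurableU.
    by rewrite -[X in measurable X]setTI; exact: mE.
  rewrite -[X in measurable X]setTI; apply: measurable_funB => //.
  exact: path_integral_measurable.
apply/seteqP; split=> w /=; rewrite !in_itv/= andbT subr_gt0.
  by move=> /(before_hitting_level _ _ _ t0).
by move=> /(before_hitting_level _ _ _ t0).
Qed.

End regulated_paths.

(** * Damped Fourier inversion *)

Section reflection.
Context {R : realType}.
Notation mu := (@lebesgue_measure R).
Notation opp := (-%R : measurableTypeR R -> measurableTypeR R).

Let mopp : measurable_fun setT opp. Proof. exact: oppr_measurable. Qed.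

Let pushE (f : R -> \bar R) :
  (\int[mu]_x f x = \int[pushforward mu opp]_x f x)%E.
Proof.
by apply: eq_measure_integral => A mA _; exact/esym/lebesgue_measureN.
Qed.

Lemma integrable_comp_opp (f : R -> R) :
  mu.-integrable setT (EFin \o f) -> mu.-integrable setT (fun y => (f (- y))%:E).
Proof.
move=> /integrableP[mf intf]; apply/integrableP; split.
  exact: (measurableT_comp (f := EFin \o f)).
move: intf; rewrite pushE ge0_integral_pushforward//.
exact: measurableT_comp.
Qed.

Lemma Rintegral_comp_opp (f : R -> R) : mu.-integrable setT (EFin \o f) ->
  \int[mu]_y f (- y) = \int[mu]_y f y.
Proof.
move=> intf; rewrite /Rintegral; congr fine.
rewrite [RHS]pushE integral_pushforward//.
- exact: measurable_int intf.
- exact: integrable_comp_opp.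
Qed.

Lemma Rintegral_odd (f : R -> R) : mu.-integrable setT (EFin \o f) ->
  (forall y, f (- y) = - f y) -> \int[mu]_y f y = 0.
Proof.
move=> intf oddf; have := Rintegral_comp_opp f intf.
have -> : \int[mu]_y f (- y) = \int[mu]_y (-1 * f y).
  by apply: eq_Rintegral => y _; rewrite oddf mulN1r.
by rewrite RintegralZl//; lra.
Qed.

Lemma Rintegral_even (f : R -> R) : mu.-integrable setT (EFin \o f) ->
  (forall y, f (- y) = f y) ->
  \int[mu]_y f y = 2 * \int[mu]_(y in `[0, +oo[) f y.
Proof.
move=> intf evenf.
have intD (D : set (measurableTypeR R)) : measurable D ->
    mu.-integrable D (EFin \o f).
  by move=> mD; apply: integrableS intf.
have CE : ~` `]-oo, 0[%classic = `[0, +oo[%classic :> set R by rewrite setCitvl.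
rewrite -[X in \int[mu]_(y in X) f y = _](setUv `]-oo, 0[%classic).
rewrite Rintegral_setU//; last 3 first.
- exact: measurableC.
- by rewrite setUv.
- exact/disj_setPCl.
rewrite CE.
rewrite mulr_natl mulr2n; congr (_ + _).
(* Removing the null point [0] makes the half-line the exact mirror image of []-oo, 0[]. *)
rewrite -[RHS](@Rintegral_itv_obnd_cbnd R 0 +oo%O); last first.
  by apply: intD.
rewrite Rintegral_mkcond -Rintegral_comp_opp; last first.
  have mN : measurable (`]-oo, 0[%classic : set (measurableTypeR R)) by [].
  by have := (integrable_mkcond _ mN).1 (intD _ mN); rewrite restrict_EFin.
rewrite [RHS]Rintegral_mkcond; apply: eq_Rintegral => y _.
by rewrite !patchE evenf; congr (if _ then _ else _);
  apply/idP/idP; rewrite !inE/= !in_itv/= andbT oppr_lt0.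
Qed.

End reflection.

(** * The inversion formula averaged over a random point *)

Section damped_inversion.
Context d (T : measurableType d) (R : realType).
Variable m : {sigma_finite_measure set T -> \bar R}.
Notation mu := (@lebesgue_measure R).
Variables (a b : R) (B L : T -> R).
Hypotheses (a0 : 0 < a) (ab : a < b).
Hypotheses (mL : measurable_fun setT L) (B0 : forall w, 0 <= B w).
Hypothesis intB : m.-integrable setT (EFin \o B).

Let mB : measurable_fun setT B.
Proof. exact/measurable_EFinP/(measurable_int m). Qed.

Let ig : mu.-integrable setT (fun y => ((b - a) / (a ^+ 2 + y ^+ 2))%:E).
Proof. exact: (integrableZl measurableT (b - a) (lorentz_integrable a a0)). Qed.

Let mhat : measurable_fun setT
    (fun z : T * measurableTypeR R => B z.1 * exp_gap_hat a b z.2 (L z.1)) /\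
  measurable_fun setT
    (fun z : T * measurableTypeR R => B z.1 * exp_gap_hat_im a b z.2 (L z.1)).
Proof.
have m1 : measurable_fun setT (fun z : T * measurableTypeR R => L z.1).
  exact: (measurableT_comp mL measurable_fst).
have m2 : measurable_fun setT (fun z : T * measurableTypeR R => z.2 : R).
  exact: measurable_snd.
have m3 : measurable_fun setT (fun z : T * measurableTypeR R => B z.1).
  exact: (measurableT_comp mB measurable_fst).
have [h1 h2] := measurable_exp_gap_hat_comp a b a0 ab _ _ _ _ m2 m1.
by split; apply: measurable_funM.
Qed.

Let le_hat w y : `|B w * exp_gap_hat a b y (L w)| <=
  B w * ((b - a) / (a ^+ 2 + y ^+ 2)).
Proof. by rewrite normrM ger0_norm// ler_wpM2l// exp_gap_hat_bound. Qed.

Let le_hat_im w y : `|B w * exp_gap_hat_im a b y (L w)| <=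
  B w * ((b - a) / (a ^+ 2 + y ^+ 2)).
Proof. by rewrite normrM ger0_norm// ler_wpM2l// exp_gap_hat_im_bound. Qed.

(** The bound [le_hat] is a product of an integrable function of [w] and an integrable function of
    [y]. *)
Lemma damped_hat_integrable :
  mu.-integrable setT (fun y =>
    (\int[m]_w (B w * exp_gap_hat a b y (L w)))%:E).
Proof.
exact: (dominated_integrable2 _ _ _ _ _ m mu setT setT _ _ measurableT
  measurableT intB ig _ mhat.1).
Qed.

Lemma damped_hat_im_integrable :
  mu.-integrable setT (fun y =>
    (\int[m]_w (B w * exp_gap_hat_im a b y (L w)))%:E).
Proof.
exact: (dominated_integrable2 _ _ _ _ _ m mu setT setT _ _ measurableT
  measurableT intB ig _ mhat.2).
Qed.

(** The imaginary kernel is odd in [y], and oddness survives integration over [w]. *)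
Lemma Rintegral_damped_hat_im :
  \int[mu]_y (\int[m]_w (B w * exp_gap_hat_im a b y (L w))) = 0.
Proof.
apply: Rintegral_odd; first exact: damped_hat_im_integrable.
move=> y; rewrite -[RHS]mulN1r -RintegralZl//; last first.
  exact: (dominated_section2_integrable _ _ _ _ _ m setT setT B _ measurableT
    intB _ mhat.2 (fun w y _ _ => le_hat_im w y) y).
by apply: eq_Rintegral => w _; rewrite exp_gap_hat_imN mulrN mulN1r.
Qed.

(** Fubini brings the integral over [y] inside, where the inversion theorem applies for each [w] at
    the point [L w]. *)
Lemma Rintegral_damped_hat_half :
  \int[mu]_(y in `[0, +oo[) (\int[m]_w (B w * exp_gap_hat a b y (L w))) =
  pi * \int[m]_w (B w * exp_gap a b (L w)).
Proof.
have ig0 : mu.-integrable `[0, +oo[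
    (fun y => ((b - a) / (a ^+ 2 + y ^+ 2))%:E).
  exact: integrableS ig.
rewrite -(dominated_Fubini _ _ _ _ _ m mu setT `[0, +oo[ _ _ measurableT _
  intB ig0 (fun w y => B w * exp_gap_hat a b y (L w)) mhat.1)//.
rewrite -RintegralZl//.
  apply: eq_Rintegral => w _; have [ihat hatE] := exp_gap_inversion a b a0 ab (L w).
  by rewrite RintegralZl// hatE mulrCA.
apply: (le_integrableR _ _ _ m setT B) => //.
  apply: measurable_funM => //; apply: measurableT_comp => //.
  by apply: continuous_measurable_fun; exact: continuous_exp_gap.
move=> w _; rewrite normrM (ger0_norm (B0 w)) ler_piMr//.
exact: exp_gap_le1.
Qed.

Lemma Rintegral_damped_hat :
  \int[mu]_y (\int[m]_w (B w * exp_gap_hat a b y (L w))) =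
  2 * pi * \int[m]_w (B w * exp_gap a b (L w)).
Proof.
rewrite Rintegral_even ?Rintegral_damped_hat_half ?mulrA//.
  exact: damped_hat_integrable.
by move=> y; apply: eq_Rintegral => w _; rewrite exp_gap_hatN.
Qed.

End damped_inversion.

Section complex_kernel.
Context {R : realType}.

(* With [a = p] and [b = p + 1] the transform of [exp_gap] is the reciprocal of
   [(p + iy)(p + 1 + iy)]. *)
Lemma kernel_Re_Im (p y k c s : R) : 0 < p ->
  let U := exp_gap_hat p (p + 1) y (- k) in
  let V := exp_gap_hat_im p (p + 1) y (- k) in
  Cexp (0 +i* (- (y * k))) * ((c +i* s) /
    ((p ^+ 2 + p - y ^+ 2) +i* (y * (2 * p + 1)))) =
  (c * U - s * V) +i* (c * V + s * U).
Proof.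
move=> p0 U V; rewrite /U /V /exp_gap_hat /exp_gap_hat_im !mulrN cosN sinN.
have A := sum_sqr_gt0 p y p0.
have B : 0 < (p + 1) ^+ 2 + y ^+ 2 by rewrite sum_sqr_gt0// addr_gt0.
rewrite /Cexp /= expR0 cosN sinN.
set C := cos _; set S := sin _.
(* This is the squared modulus of [(p + iy)(p + 1 + iy)], hence a product of two positive
   factors. *)
have N0 : (p ^+ 2 + p - y ^+ 2) ^+ 2 + (y * (2 * p + 1)) ^+ 2 != 0.
  rewrite [X in X != 0](_ : _ = (p ^+ 2 + y ^+ 2) * ((p + 1) ^+ 2 + y ^+ 2)).
    by rewrite mulf_neq0// gt_eqF.
  by ring.
by simpc; congr (_ +i* _); field; rewrite N0 !gt_eqF.
Qed.

End complex_kernel.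

(** * The stock model *)

Lemma continuous_borelRn_measurable (R : realType) (n : nat)
    (f : 'rV[R]_n -> R) :
  continuous f -> measurable_fun setT (f : borelRn R n -> R).
Proof.
move=> /continuousP cf; apply: (measurability _ (RGenOpens.measurableE R)).
move=> _ [_ [a [b ->] <-]]; rewrite setTI; apply: sub_sigma_algebra.
exact/cf/interval_open.
Qed.

Lemma continuous_dot (R : realType) (n : nat) (u : 'rV[R]_n) :
  continuous (dot u).
Proof.
apply: (@continuous_big R 'I_n +%R 0 xpredT (@add_continuous R)
  'rV[R]_n (index_enum 'I_n) (fun k x => u 0 k * x 0 k)) => k _ x.
apply: (@cvgM _ _ (nbhs x) (nbhs_filter x) (fun=> u 0 k) (fun x : 'rV[R]_n => x 0 k)).
  exact: cvg_cst.
exact: coord_continuous.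
Qed.

Lemma continuous_rate (R : realType) (m n : nat) (lemn : (m <= n)%N) (c : R)
    (u : 'rV[R]_m) : continuous (fun x : 'rV[R]_n => c + dot u (projI lemn x)).
Proof.
have cproj k : continuous (fun x : 'rV[R]_n => projI lemn x 0 k).
  rewrite (_ : (fun _ => _) = fun x : 'rV[R]_n => x 0 (inI lemn k)).
    exact: coord_continuous.
  by apply/funext => x; rewrite mxE.
move=> x.
apply: (@cvgD _ _ _ (nbhs x) (nbhs_filter x) (fun=> c) (dot u \o projI lemn)).
  exact: cvg_cst.
move: x; apply: (@continuous_big R 'I_m +%R 0 xpredT (@add_continuous R)
  'rV[R]_n (index_enum 'I_m) (fun k y => u 0 k * projI lemn y 0 k)) => k _ y.
apply: (@cvgM _ _ (nbhs y) (nbhs_filter y) (fun=> u 0 k) (fun y : 'rV[R]_n => projI lemn y 0 k)).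
  exact: cvg_cst.
exact: cproj.
Qed.

Section stock.
Context (R : realType) (m n : nat) (lemn : (m <= n)%N)
  (d : measure_display) (Omega : measurableType d)
  (P : 'rV[R]_n -> probability Omega R) (X : R -> Omega -> borelRn R n)
  (q : affine_params R m n) (X_affine : affine_process lemn P X q).

Section rate.
Context (c : R) (u : 'rV[R]_m).
Hypotheses (c0 : 0 <= c) (u0 : forall i, 0 <= u 0 i).
(** Common form of the interest rate and the hazard rate, so that the results on regulated paths
    cover both [int_rate] and [int_hazard]. *)
Let Y (s : R) (w : Omega) : R := c + dot u (projI lemn (X s w)).

Let mY s : 0 <= s -> measurable_fun setT (Y s).
Proof.
move=> s0; have mX := ap_measurable X_affine s0.
exact: (measurableT_comp (continuous_borelRn_measurable _ _ _
  (continuous_rate _ _ _ lemn c u)) mX).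
Qed.

Let Y_right w s : 0 <= s -> Y v w @[v --> s^'+] --> Y s w.
Proof.
move=> s0; have [Xr _] := ap_rcll X_affine w.
exact: (cvg_comp _ _ (Xr s s0) (continuous_rate _ _ _ lemn c u (X s w))).
Qed.

Let Y_left w s : 0 < s -> exists l : R, Y v w @[v --> s^'-] --> l.
Proof.
move=> s0; have [_ Xl] := ap_rcll X_affine w; have [l Xsl] := Xl s s0.
exists (c + dot u (projI lemn l)).
exact: (cvg_comp _ _ Xsl (continuous_rate _ _ _ lemn c u l)).
Qed.

Let Y_ge0 s w : 0 <= s -> 0 <= Y s w.
Proof.
move=> s0; apply: addr_ge0 => //; apply: sumr_ge0 => i _; apply: mulr_ge0 => //.
by rewrite mxE; exact: (ap_stateD X_affine).
Qed.

Lemma rate_integral_measurable t :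
  measurable_fun setT (path_integral _ _ _ Y t).
Proof. exact: path_integral_measurable. Qed.

Lemma rate_survival_measurable (E : Omega -> R) t :
  0 <= t -> measurable_fun setT E ->
  measurable [set w | (t%:E < hitting_time _ _ _ Y (E w) w)%E].
Proof. exact: survival_measurable. Qed.

End rate.

Variables (st : stock_params R m n) (st_adm : stock_admissible st).
Variables (E : Omega -> R) (mE : measurable_fun setT E).
Variables (t : R) (t0 : 0 <= t).

Lemma alive_measurable : measurable (alive lemn X st E t).
Proof. by have [_ _ c0 g0] := st_adm; exact: rate_survival_measurable. Qed.

Lemma int_rate_measurable : measurable_fun setT (int_rate lemn X st t).
Proof. by have [d0 dl0 _ _] := st_adm; exact: rate_integral_measurable. Qed.

Lemma log_S_measurable : measurable_fun setT (log_S lemn X st t).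
Proof.
have [_ _ c0 g0] := st_adm.
apply: measurable_funD; last exact: rate_integral_measurable.
apply: measurable_funD; last exact: int_rate_measurable.
apply: measurable_funD => //.
exact: (measurableT_comp (continuous_borelRn_measurable _ _ _
  (continuous_dot _ _ _)) (ap_measurable X_affine t0)).
Qed.

End stock.

(** Real and imaginary parts of [e^(iy(l - k)) = e^(iyl) e^(-iyk)]; this separates the random
    log-price from the strike. *)
Lemma exp_gap_hat_shift (R : realType) (a b y l k : R) :
  exp_gap_hat a b y (l - k) = cos (y * l) * exp_gap_hat a b y (- k)
    - sin (y * l) * exp_gap_hat_im a b y (- k) /\
  exp_gap_hat_im a b y (l - k) = cos (y * l) * exp_gap_hat_im a b y (- k)
    + sin (y * l) * exp_gap_hat a b y (- k).
Proof.
rewrite /exp_gap_hat /exp_gap_hat_im mulrDr cosD sinD; split; ring.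
Qed.

(** * Call prices for a discount factor [A], a log-price [L] and a survival event [I] *)

Section discounted_call.
Context d (T : measurableType d) (R : realType) (m : probability T R).
Variables (A L : T -> R) (I : set T) (p : R).
Hypotheses (p0 : 0 < p) (mA : measurable_fun setT A).
Hypotheses (A0 : forall w, 0 <= A w).
Hypotheses (mL : measurable_fun setT L) (mI : measurable I).

Definition damped (w : T) : R := A w * expR ((p + 1) * L w) * \1_I w.

Lemma damped_ge0 w : 0 <= damped w.
Proof. by rewrite !mulr_ge0 ?expR_ge0. Qed.

Lemma damped_measurable : measurable_fun setT damped.
Proof.
apply: measurable_funM; last exact: measurable_indic.
apply: measurable_funM => //; apply: measurableT_comp => //.
exact: measurable_funM.
Qed.

Lemma damped_integrable :
  ('E_m[fun w => (A w * ((expR (L w) * \1_I w) `^ (p + 1)) * \1_I w)%R] < +oo)%E ->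
  m.-integrable setT (EFin \o damped).
Proof.
rewrite unlock => fin_moment; apply/integrableP; split.
  exact/measurable_EFinP/damped_measurable.
rewrite [ltLHS](_ : _ = \int[m]_w
  (A w * ((expR (L w) * \1_I w) `^ (p + 1)) * \1_I w)%R%:E)%E//.
(* Off [I] both integrands vanish through the indicator; on [I] the power of [expR (L w)] is the
   exponential of [(p + 1) * L w]. *)
apply: eq_integral => w _ /=; rewrite ger0_norm ?damped_ge0// /damped indicE.
by case: (w \in I); rewrite ?mulr0// !mulr1 -expRM [L w * _]mulrC.
Qed.

(** Off [I] and for [L w <= k] both sides are zero. Otherwise the factor [e^(-pk)] and the weight
    [e^((p+1) L)] turn the two terms of [exp_gap] at [L - k] into [e^L] and [e^k]. *)
Lemma damped_payoff k w :
  A w * Num.max (expR (L w) * \1_I w - expR k) 0 =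
  expR (- (p * k)) * (damped w * exp_gap p (p + 1) (L w - k)).
Proof.
rewrite /damped indicE; case: (w \in I); last first.
  by rewrite !mulr0 mul0r mulr0 sub0r max_r ?mulr0// oppr_le0 expR_ge0.
rewrite !mulr1 /exp_gap mulrA mulrCA -!mulrA; congr (_ * _).
have [lk|kl] := leP (L w) k.
  by rewrite !max_r ?subr_le0 ?ler_expR// !mulr0 subrr !mulr0.
rewrite !max_l ?subr_ge0 ?ler_expR ?(ltW kl)//.
rewrite !mulrBr -!expRD; congr (expR _ - expR _); ring.
Qed.

Hypothesis intB : m.-integrable setT (EFin \o damped).

Lemma moment_damped (y : R) :
  Cintegral m setT (fun w => (A w)%:C * Cexp (((p + 1) +i* y) * (L w)%:C)
    * (\1_I w)%:C) =
  (\int[m]_w (damped w * cos (y * L w))) +i* (\int[m]_w (damped w * sin (y * L w))).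
Proof.
have E w : (A w)%:C * Cexp (((p + 1) +i* y) * (L w)%:C) * (\1_I w)%:C =
    (damped w * cos (y * L w)) +i* (damped w * sin (y * L w)).
  by rewrite /Cexp /damped; simpc; congr (_ +i* _); ring.
by rewrite /Cintegral; congr (_ +i* _); apply: eq_Rintegral => w _; rewrite E.
Qed.

(** The kernel at [- k] is constant in [w], so it moves inside the expectation, where it recombines
    with [cos (y L)] and [sin (y L)] into the kernel at [L - k]. *)
Lemma kernel_moment (y k : R) :
  Cexp (0 +i* (- (y * k))) *
  (Cintegral m setT (fun w => (A w)%:C * Cexp (((p + 1) +i* y) * (L w)%:C)
      * (\1_I w)%:C)
    / ((p ^+ 2 + p - y ^+ 2) +i* (y * (2 * p + 1)))) =
  (\int[m]_w (damped w * exp_gap_hat p (p + 1) y (L w - k))) +i*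
  (\int[m]_w (damped w * exp_gap_hat_im p (p + 1) y (L w - k))).
Proof.
rewrite moment_damped kernel_Re_Im//.
have myL : measurable_fun setT (fun w => y * L w) by exact: measurable_funM.
have ic : m.-integrable setT (EFin \o (fun w => damped w * cos (y * L w))).
  apply: (le_integrableR _ _ _ m setT damped) => //.
    apply: measurable_funM; first exact: damped_measurable.
    apply: (measurableT_comp (f := @cos R)) => //.
    by apply: continuous_measurable_fun; exact: continuous_cos.
  move=> w _; rewrite normrM (ger0_norm (damped_ge0 w)).
  by rewrite ler_piMr ?damped_ge0// cos_max.
have is_ : m.-integrable setT (EFin \o (fun w => damped w * sin (y * L w))).
  apply: (le_integrableR _ _ _ m setT damped) => //.
    apply: measurable_funM; first exact: damped_measurable.
    apply: (measurableT_comp (f := @sin R)) => //.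
    by apply: continuous_measurable_fun; exact: continuous_sin.
  move=> w _; rewrite normrM (ger0_norm (damped_ge0 w)).
  by rewrite ler_piMr ?damped_ge0// sin_max.
have iZ (f : T -> R) c : m.-integrable setT (EFin \o f) ->
    m.-integrable setT (EFin \o (fun w => f w * c)).
  by move=> intf; exact: (integrableZr measurableT c intf).
congr (_ +i* _).
  rewrite -!RintegralZr// -RintegralB//; [|exact: iZ|exact: iZ].
  by apply: eq_Rintegral => w _;
    rewrite (exp_gap_hat_shift _ p (p + 1) y (L w) k).1 [RHS]mulrBr !mulrA.
rewrite -!RintegralZr// -RintegralD//; [|exact: iZ|exact: iZ].
by apply: eq_Rintegral => w _;
  rewrite (exp_gap_hat_shift _ p (p + 1) y (L w) k).2 [RHS]mulrDr !mulrA.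
Qed.

(** Expectation of [damped_payoff]; it is finite because [exp_gap] is bounded by [1] and [damped] is
    integrable. *)
Lemma payoff_expectation k :
  ('E_m[fun w => (A w * Num.max (expR (L w) * \1_I w - expR k) 0)%R])%E =
  (expR (- (p * k)) *
    \int[m]_w (damped w * exp_gap p (p + 1) (L w - k)))%:E.
Proof.
have igap : m.-integrable setT
    (EFin \o (fun w => damped w * exp_gap p (p + 1) (L w - k))).
  apply: (le_integrableR _ _ _ m setT damped) => //.
    apply: measurable_funM; first exact: damped_measurable.
    apply: (measurableT_comp (f := exp_gap p (p + 1))).
      by apply: continuous_measurable_fun; exact: continuous_exp_gap.
    exact: measurable_funB.
  move=> w _; rewrite normrM (ger0_norm (damped_ge0 w)).
  by rewrite ler_piMr ?damped_ge0// exp_gap_le1// ltrDl.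
rewrite unlock; under eq_integral do rewrite damped_payoff EFinM.
rewrite integralZl// EFinM; congr (_ * _)%E.
by rewrite /Rintegral fineK//; exact: integrable_fin_num.
Qed.

(** By [kernel_moment] the integrand is an average of kernels at [L - k]. Its real part integrates
    to [2 pi] times the damped expectation over the line and to [pi] times it over the half-line,
    and its imaginary part integrates to [0]. *)
Lemma call_inversion k :
  let c := ('E_m[fun w => (A w * Num.max (expR (L w) * \1_I w - expR k) 0)%R])%E in
  let G y := Cexp (0 +i* (- (y * k))) *
    (Cintegral m setT (fun w => (A w)%:C * Cexp (((p + 1) +i* y) * (L w)%:C)
        * (\1_I w)%:C)
      / ((p ^+ 2 + p - y ^+ 2) +i* (y * (2 * p + 1)))) in
  [/\ c \is a fin_num, Cintegrable lebesgue_measure setT G,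
      (fine c)%:C = (expR (- (p * k)) / (2 * pi))%:C
        * Cintegral lebesgue_measure setT G
    & fine c = expR (- (p * k)) / pi
        * Rintegral lebesgue_measure `[0, +oo[ (fun y => complex.Re (G y))].
Proof.
move=> c G; have p1 : p < p + 1 by rewrite ltrDl.
have mLk : measurable_fun setT (fun w => L w - k) by exact: measurable_funB.
have GE : G = fun y =>
    (\int[m]_w (damped w * exp_gap_hat p (p + 1) y (L w - k))) +i*
    (\int[m]_w (damped w * exp_gap_hat_im p (p + 1) y (L w - k))).
  by apply/funext => y; exact: kernel_moment.
have pi0 : pi != 0 :> R by rewrite gt_eqF ?pi_gt0.
rewrite /c payoff_expectation GE; split.
- by [].
- split.
    exact: (damped_hat_integrable _ _ _ m p (p + 1) damped (fun w => L w - k)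
      p0 p1 mLk damped_ge0 intB).
  exact: (damped_hat_im_integrable _ _ _ m p (p + 1) damped (fun w => L w - k)
    p0 p1 mLk damped_ge0 intB).
- rewrite /Cintegral/= Rintegral_damped_hat// ?Rintegral_damped_hat_im//;
    try exact: damped_ge0.
  simpc; congr (_ +i* _).
  move: pi pi0 (Rintegral _ _ _) => z z0 r; field.
  exact: z0.
- have H := Rintegral_damped_hat_half _ _ _ m p (p + 1) damped
    (fun w => L w - k) p0 p1 mLk damped_ge0 intB.
  transitivity (expR (- (p * k)) / pi *
      (pi * \int[m]_w (damped w * exp_gap p (p + 1) (L w - k)))).
    rewrite /=; move: pi pi0 (Rintegral _ _ _) => z z0 r; field.
    exact: z0.
  by congr (_ * _); exact/esym/H.
Qed.

End discounted_call.

Theorem theorem3p6 (R : realType) (m n : nat) (n_gt0 : (1 <= n)%N)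
    (lemn : (m <= n)%N)
    (d : measure_display) (Omega : measurableType d)
    (P : 'rV[R]_n -> probability Omega R)
    (X : R -> Omega -> borelRn R n)
    (q : affine_params R m n)
    (q_adm : admissible lemn q)
    (X_affine : affine_process lemn P X q)
    (st : stock_params R m n) (st_adm : stock_admissible st)
    (E : Omega -> R) (E_exp : std_exponential_indep lemn P X E)
    (t : R) (x : 'rV[R]_n) (t_ge0 : 0 <= t) (xD : stateD lemn x)
    (p : R) (p_gt0 : 0 < p)
    (pU : moment_domain lemn P X st E t x (p + 1)%:C) :
  let c := call_price lemn P X st E t x in
  let g := g_call lemn P X st E t x p in
  forall k : R,
  [/\ c k \is a fin_num,
      Cintegrable lebesgue_measure setT
        (fun y : R => Cexp (0 +i* (- (y * k))) * g y),
      (fine (c k))%:C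
      = (expR (- (p * k)) / (2 * pi))%:C
        * Cintegral lebesgue_measure setT
            (fun y : R => Cexp (0 +i* (- (y * k))) * g y)
    & fine (c k)
      = expR (- (p * k)) / pi
        * Rintegral lebesgue_measure `[0, +oo[
            (fun y : R => complex.Re (Cexp (0 +i* (- (y * k))) * g y))].
Proof.
move=> c g k; have [mE _] := E_exp.
have mI := alive_measurable _ _ _ _ _ _ _ _ _ X_affine _ st_adm _ mE _ t_ge0.
have mr := int_rate_measurable _ _ _ _ _ _ _ _ _ X_affine _ st_adm t.
have mL := log_S_measurable _ _ _ _ _ _ _ _ _ X_affine _ st_adm _ t_ge0.
have mA : measurable_fun setT (fun w => expR (- int_rate lemn X st t w)).
  by apply: measurableT_comp => //; exact: measurableT_comp.
have A0 w : 0 <= expR (- int_rate lemn X st t w) by exact: expR_ge0.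
(* The moment hypothesis [pU] is the finiteness condition for [A = e^(-R_t)], [L = log S_t] and [I]
   the event of survival past [t]. *)
have intB := damped_integrable _ _ _ (P x) _ _ _ p mA A0 mL mI pU.
exact: (call_inversion _ _ _ (P x) _ _ _ p p_gt0 mA A0 mL mI intB k).
Qed.
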